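(* Let $R$ be a commutative Noetherian ring with identity, $\mathfrak{a}$ an ideal of $R$, $M$ a finitely generated $R$-module and $n$ a natural number ($n\ge 1$). Then the following are equivalent: (i) For every $\mathrm{f}$-generating set $\{x_1,\ldots,x_s\}$ of $\mathfrak{a}$ with respect to $M$ with $s\ge n$, any $n$ elements of it form an unconditioned $\mathfrak{a}$-weak sequence on $M$. (ii) There exists an $\mathrm{f}$-generating set $\{x_1,\ldots,x_s\}$ of $\mathfrak{a}$ with respect to $M$ such that $s\ge n$ and any $n$ elements in it form an unconditioned $\mathfrak{a}$-weak sequence on $M$. (iii) There exists an $\mathrm{f}$-generating set $\{x_1,\ldots,x_s\}$ of $\mathfrak{a}$ with respect to $M$ with $s\ge n$ such that the natural map $\lambda^i_M:H^i(x_1,\ldots,x_s,M)\to H^i_{\mathfrak{a}}(M)$ is surjective for all $0\le i\le n-1$.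
   Context: Sequences. A sequence $x_1,\ldots,x_r$ of elements of $R$ is an $\mathfrak{a}$-filter regular sequence on $M$ if $\langle x_1,\ldots,x_{i-1}\rangle M:_M x_i\subseteq\bigcup_{t\in\mathbb{N}}\left(\langle x_1,\ldots,x_{i-1}\rangle M:_M\mathfrak{a}^t\right)$ for all $i=1,\ldots,r$; it is an unconditioned $\mathfrak{a}$-filter regular sequence on $M$ if it is an $\mathfrak{a}$-filter regular sequence on $M$ in any order. It is an $\mathfrak{a}$-weak sequence on $M$ if $\langle x_1,\ldots,x_{i-1}\rangle M:_M x_i\subseteq\langle x_1,\ldots,x_{i-1}\rangle M:_M\mathfrak{a}$ for all $i=1,\ldots,r$; it is an unconditioned $\mathfrak{a}$-weak sequence on $M$ if $x_1^{\alpha_1},\ldots,x_r^{\alpha_r}$ is an $\mathfrak{a}$-weak sequence on $M$ in any order for all positive integers $\alpha_1,\ldots,\alpha_r$. An $\mathrm{f}$-generating set of $\mathfrak{a}$ with respect to $M$ is a (finite) set of generators $y_1,\ldots,y_r$ of $\mathfrak{a}$ which form an unconditioned $\mathfrak{a}$-filter regular sequence on $M$. Koszul (co)homology. For $\underline{x}=x_1,\ldots,x_s$ in $R$, $K_\bullet(\underline{x},M)$ is the Koszul complex, $H_p(\underline{x},M)$ its homology, and $H^i(\underline{x},M):=H_{s-i}(\underline{x},M)$. For $1\le u\le v$ there is a chain map $K_\bullet(x_1^u,\ldots,x_s^u,M)\to K_\bullet(x_1^v,\ldots,x_s^v,M)$ which in degree $p$ multiplies the component at the basis element $e_{j_1}\wedge\cdots\wedge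 e_{j_p}$ by $\prod_{j\notin\{j_1,\ldots,j_p\}}x_j^{v-u}$. These form a direct system and there is a natural isomorphism $H^i_{\langle\underline{x}\rangle}(M)\cong\varinjlim_{u}H_{s-i}(x_1^u,\ldots,x_s^u,M)$, where $H^i_{\langle\underline{x}\rangle}$ is local cohomology. The natural map $\lambda^i_M:H^i(\underline{x},M)\to H^i_{\langle\underline{x}\rangle}(M)$ is the resulting map from the term $u=1$ to the direct limit. *)

(* Defs.v *)
From HB Require Import structures.
From mathcomp Require Import all_boot all_order all_algebra.
From mathcomp Require Import perm ring_quotient.
From mathcomp Require Import all_classical.
Set Implicit Arguments.
Unset Strict Implicit.
Unset Printing Implicit Defensive.
Import GRing.Theory.
Local Open Scope classical_set_scope.
Local Open Scope ring_scope.
Local Open Scope quotient_scope.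

Section Submodules.
Variable R : comPzRingType.

Definition submodule (V : lmodType R) (N : set V) : Prop :=
  GRing.submod_closed [in N].

Definition span (V : lmodType R) (G : set V) : set V := smallest (@submodule V) G.

Definition ideal (I : set R) : Prop := submodule (I : set R^o).

Definition ideal_gen (G : set R) : set R := span (G : set R^o).

Definition smul (V : lmodType R) (I : set R) (N : set V) : set V :=
  span [set r *: m | r in I & m in N].

Definition idealX (I : set R) (t : nat) : set R :=
  iter t (@smul R^o I) setT.

Definition colon_elt (V : lmodType R) (N : set V) (r : R) : set V :=
  [set m | N (r *: m)].

Definition colon (V : lmodType R) (N : set V) (I : set R) : set V :=
  [set m | forall r, I r -> N (r *: m)].

Definition noetherian : Prop :=
  forall I : set R, ideal I -> exists (s : nat) (y : 'I_s -> R), ideal_gen (range y) = I.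

Definition fingen (V : lmodType R) : Prop :=
  exists (s : nat) (m : 'I_s -> V), span (range m) = setT.

End Submodules.

Section Sequences.
Variables (R : comPzRingType) (a : set R) (M : lmodType R).

Definition prefix_submod (r : nat) (x : 'I_r -> R) (i : 'I_r) : set M :=
  smul (ideal_gen [set x j | j in [set j : 'I_r | (j < i)%N]]) setT.

Definition filter_regular (r : nat) (x : 'I_r -> R) : Prop :=
  forall i : 'I_r, colon_elt (prefix_submod x i) (x i) `<=`
    \bigcup_t colon (prefix_submod x i) (idealX a t).

Definition uncond_filter_regular (r : nat) (x : 'I_r -> R) : Prop :=
  forall g : 'S_r, filter_regular (fun i => x (g i)).

Definition weak_sequence (r : nat) (x : 'I_r -> R) : Prop :=
  forall i : 'I_r, colon_elt (prefix_submod x i) (x i) `<=`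
    colon (prefix_submod x i) a.

Definition uncond_weak_sequence (r : nat) (x : 'I_r -> R) : Prop :=
  forall alpha : 'I_r -> nat, (forall i, 0 < alpha i)%N ->
  forall g : 'S_r, weak_sequence (fun i => x (g i) ^+ alpha (g i)).

(* The generators form an indexed family, so repetitions are allowed: with
   pairwise distinct elements the zero ideal would have no f-generating set
   of more than one element. *)
Definition f_generating (s : nat) (x : 'I_s -> R) : Prop :=
  ideal_gen (range x) = a /\ uncond_filter_regular x.

End Sequences.

Section QuotientModule.
Variables (R : pzRingType) (V : lmodType R) (N : submodClosed V).

(* Over a ring, a GRing.SubmodClosed predicate is closed under opposite, but
   the library does not infer the ZmodClosed instance Quotient.quot needs. *)
Definition zmod_pred : {pred V} := N.
Fact zmod_pred_closed : GRing.zmod_closed zmod_pred.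
Proof. exact: GRing.subsemimod_closedB (GRing.subsemimodClosedP N). Qed.
HB.instance Definition _ := GRing.isZmodClosed.Build V zmod_pred zmod_pred_closed.

Definition quotmod : Type := Quotient.quot zmod_pred.
HB.instance Definition _ := GRing.Zmodule.on quotmod.
HB.instance Definition _ : EqQuotient V (Quotient.equiv zmod_pred) quotmod :=
  EqQuotient.on quotmod.

Definition quotmod_pi (v : V) : quotmod := \pi_(Quotient.quot zmod_pred) v.

Lemma quotmod_piP (v w : V) : (quotmod_pi v = quotmod_pi w) <-> (v - w \in N).
Proof.
rewrite -[_ \in N]/(v - w \in zmod_pred) Quotient.idealrBE.
by split=> [h|/eqP //]; apply/eqP.
Qed.

Definition quotmod_repr (q : quotmod) : V := repr q.

Lemma quotmod_reprK (q : quotmod) : quotmod_pi (quotmod_repr q) = q.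
Proof. exact: reprK. Qed.

Fact quotmod_pi_zmod : zmod_morphism quotmod_pi.
Proof. by move=> v w; rewrite /quotmod_pi raddfB. Qed.

Definition quotmod_scale (r : R) (q : quotmod) : quotmod :=
  quotmod_pi (r *: quotmod_repr q).

Lemma quotmod_scale_pi r v : quotmod_scale r (quotmod_pi v) = quotmod_pi (r *: v).
Proof.
apply/quotmod_piP; rewrite -scalerBr rpredZ //.
by apply/quotmod_piP; rewrite quotmod_reprK.
Qed.

Lemma quotmod_piD v w : quotmod_pi (v + w) = quotmod_pi v + quotmod_pi w.
Proof. exact: raddfD. Qed.

Fact quotmod_scalerA r t q :
  quotmod_scale r (quotmod_scale t q) = quotmod_scale (r * t) q.
Proof. by rewrite -[q]quotmod_reprK !quotmod_scale_pi scalerA. Qed.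
Fact quotmod_scale1r : left_id 1 quotmod_scale.
Proof. by move=> q; rewrite -[q]quotmod_reprK quotmod_scale_pi scale1r. Qed.
Fact quotmod_scalerDr : right_distributive quotmod_scale +%R.
Proof.
move=> r p q; rewrite -[p]quotmod_reprK -[q]quotmod_reprK.
by rewrite -quotmod_piD !quotmod_scale_pi scalerDr quotmod_piD.
Qed.
Fact quotmod_scalerDl q : {morph quotmod_scale^~ q : r t / r + t}.
Proof.
by move=> r t; rewrite -[q]quotmod_reprK !quotmod_scale_pi scalerDl quotmod_piD.
Qed.
HB.instance Definition _ := GRing.Zmodule_isLmodule.Build R quotmod
  quotmod_scalerA quotmod_scale1r quotmod_scalerDr quotmod_scalerDl.

Fact quotmod_pi_linear : linear quotmod_pi.
Proof. by move=> r v w; rewrite quotmod_piD -quotmod_scale_pi. Qed.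
HB.instance Definition _ :=
  GRing.isLinear.Build R V quotmod _ quotmod_pi quotmod_pi_linear.

End QuotientModule.

Section QuotientMap.
Variables (R : pzRingType) (V W : lmodType R).
Variables (N : submodClosed V) (P : submodClosed W) (f : {linear V -> W}).
Hypothesis fNP : forall v, v \in N -> f v \in P.

Definition quotmod_map (_ : forall v, v \in N -> f v \in P) (q : quotmod N) :
  quotmod P := quotmod_pi P (f (quotmod_repr q)).

Lemma quotmod_mapE v : quotmod_map fNP (quotmod_pi N v) = quotmod_pi P (f v).
Proof.
apply/quotmod_piP; rewrite -raddfB; apply: fNP.
by apply/quotmod_piP; rewrite quotmod_reprK.
Qed.

Fact quotmod_map_linear : linear (quotmod_map fNP).
Proof.
move=> r p q; rewrite -[p]quotmod_reprK -[q]quotmod_reprK.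
by rewrite -linearP !quotmod_mapE !linearP.
Qed.
HB.instance Definition _ :=
  GRing.isLinear.Build R (quotmod N) (quotmod P) _ (quotmod_map fNP) quotmod_map_linear.
End QuotientMap.

Section Koszul.
Variables (R : comPzRingType) (M : lmodType R) (s : nat).

(* The direct sum of all the degrees: the value at J = {j_1 < ... < j_p} is the
   coefficient of the basis element e_{j_1} /\ ... /\ e_{j_p}. *)
Definition koszul : Type := {ffun {set 'I_s} -> M}.
HB.instance Definition _ := GRing.Lmodule.on koszul.

Implicit Types (x : 'I_s -> R) (f g : koszul) (p : nat).

Definition koszul_homog p : {pred koszul} :=
  [pred f : koszul | [forall J, (f J != 0) ==> (#|J| == p)]].

(* d (m e_J) = \sum_(j in J) (-1)^#{i in J | i < j} x_j m e_(J \ j). *)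
Definition koszul_d x (f : koszul) : koszul :=
  [ffun I : {set 'I_s} => \sum_(j | j \notin I)
     ((-1) ^+ #|[pred i in I | (i < j)%N]| * x j) *: f (j |: I)].

Fact koszul_d_linear x : linear (koszul_d x).
Proof.
move=> r f g; apply/ffunP=> I; rewrite !ffunE scaler_sumr -big_split /=.
by apply: eq_bigr => j _; rewrite !ffunE scalerDr !scalerA mulrC.
Qed.
HB.instance Definition _ x :=
  GRing.isLinear.Build R koszul koszul _ (koszul_d x) (koszul_d_linear x).

Lemma koszul_dd x (f : koszul) : koszul_d x (koszul_d x f) = 0.
Proof.
apply/ffunP=> I; rewrite !ffunE.
pose F (j k : 'I_s) : M :=
  ((-1) ^+ #|[pred i in I | (i < j)%N]| * x j) *:
  (((-1) ^+ #|[pred i in j |: I | (i < k)%N]| * x k) *: f (k |: (j |: I))).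
have Fsym j k : j \notin I -> k \notin I -> (j < k)%N -> F j k = - F k j.
  move=> jI kI jk; rewrite /F !scalerA -scaleNr finset.setUCA; congr (_ *: _).
  have -> : #|[pred i in k |: I | (i < j)%N]| = #|[pred i in I | (i < j)%N]|.
    apply: eq_card => i; rewrite !inE; case: (eqVneq i k) => //= ->.
    by rewrite ltnNge (ltnW jk) /= andbF.
  have -> : #|[pred i in j |: I | (i < k)%N]| = #|[pred i in I | (i < k)%N]|.+1.
    rewrite -[RHS]add1n (cardD1 j) !inE eqxx jk /=; congr (_ + _)%N.
    apply: eq_card => i; rewrite !inE; case: (eqVneq i j) => //= ->.
    by rewrite (negPf jI).
  rewrite exprS mulN1r !(mulNr, mulrN); congr (- _).
  by rewrite mulrACA [RHS]mulrACA [x k * _]mulrC; congr (_ * _); rewrite mulrC.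
have -> : \sum_(j | j \notin I)
    ((-1) ^+ #|[pred i in I | (i < j)%N]| * x j) *: koszul_d x f (j |: I) =
    \sum_(j | j \notin I) \sum_(k | k \notin I)
      ((if (j < k)%N then F j k else 0) + (if (k < j)%N then F j k else 0)).
  apply: eq_bigr => j jI; rewrite ffunE scaler_sumr.
  rewrite [RHS](bigD1 j jI) /= ltnn addr0 add0r.
  apply: eq_big => k; rewrite !inE negb_or; first by rewrite andbC.
  move=> /andP[kj kI].
  by case: (ltngtP j k) kj => [||/val_inj ->]; rewrite ?addr0 ?add0r // eqxx.
under eq_bigr do rewrite big_split /=.
rewrite big_split /= [X in _ + X]exchange_big /= -big_split /=.
rewrite big1 // => j jI; rewrite -big_split big1 //= => k kI.
by case: ifP => [jk|]; rewrite ?addr0 // Fsym // addNr.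
Qed.

Definition koszul_cycle x p : {pred koszul} :=
  [pred f | (f \in koszul_homog p) && (koszul_d x f == 0)].

Definition koszul_boundary x p : {pred koszul} :=
  [pred f | `[< exists2 g, g \in koszul_homog p.+1 & f = koszul_d x g >]].

Lemma koszul_homogP p f :
  reflect (forall J : {set 'I_s}, #|J| != p -> f J = 0) (f \in koszul_homog p).
Proof.
apply: (iffP forallP) => h J; first by have := h J; case: eqP => //= _ /[swap] /negPf->.
by apply/implyP; apply: contraR => /h ->.
Qed.

Fact koszul_homog_submod p : GRing.submod_closed (koszul_homog p).
Proof.
split=> [|r f g /koszul_homogP hf /koszul_homogP hg]; apply/koszul_homogP => J hJ.
  by rewrite ffunE.
by rewrite !ffunE hf // hg // scaler0 addr0.
Qed.
HB.instance Definition _ p :=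
  GRing.isSubmodClosed.Build R koszul (koszul_homog p) (koszul_homog_submod p).

Lemma koszul_cycleE x p f :
  (f \in koszul_cycle x p) = (f \in koszul_homog p) && (koszul_d x f == 0).
Proof. by []. Qed.

Lemma koszul_boundaryP x p f :
  reflect (exists2 g, g \in koszul_homog p.+1 & f = koszul_d x g)
          (f \in koszul_boundary x p).
Proof. exact: asboolP. Qed.

Fact koszul_cycle_submod x p : GRing.submod_closed (koszul_cycle x p).
Proof.
split=> [|r f g]; rewrite !koszul_cycleE; first by rewrite rpred0 linear0 eqxx.
move=> /andP[hf /eqP df] /andP[hg /eqP dg].
by rewrite rpredD ?rpredZ //= linearD linearZ /= df dg scaler0 addr0.
Qed.
HB.instance Definition _ x p :=
  GRing.isSubmodClosed.Build R koszul (koszul_cycle x p) (koszul_cycle_submod x p).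

Record koszul_cycles x p := KoszulCycle {
  koszul_cycle_val : koszul;
  _ : koszul_cycle_val \in koszul_cycle x p
}.
HB.instance Definition _ x p := [isSub for @koszul_cycle_val x p].
HB.instance Definition _ x p := [Choice of koszul_cycles x p by <:].
HB.instance Definition _ x p :=
  [SubChoice_isSubLmodule of koszul_cycles x p by <:].

Definition koszul_boundaries x p : {pred koszul_cycles x p} :=
  [pred z | val z \in koszul_boundary x p].

Lemma koszul_boundariesE x p (z : koszul_cycles x p) :
  (z \in @koszul_boundaries x p) = (val z \in koszul_boundary x p).
Proof. by []. Qed.

Fact koszul_boundaries_submod x p : GRing.submod_closed (@koszul_boundaries x p).
Proof.
split=> [|r z w]; rewrite !koszul_boundariesE.
  by apply/koszul_boundaryP; exists 0; rewrite ?rpred0 ?linear0.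
move=> /koszul_boundaryP[f hf zf] /koszul_boundaryP[g hg wg].
apply/koszul_boundaryP; exists (r *: f + g).
  by rewrite rpredD ?rpredZ.
by rewrite !linearP /= -zf -wg.
Qed.
HB.instance Definition _ x p := GRing.isSubmodClosed.Build R (koszul_cycles x p)
  (@koszul_boundaries x p) (@koszul_boundaries_submod x p).

Definition koszul_homology x p : lmodType R := quotmod (@koszul_boundaries x p).

Definition koszul_cohomology x (i : nat) : lmodType R := koszul_homology x (s - i).

Definition koszul_tr x (u v : nat) (f : koszul) : koszul :=
  [ffun J : {set 'I_s} => (\prod_(j | j \notin J) x j ^+ (v - u)) *: f J].

Fact koszul_tr_linear x u v : linear (koszul_tr x u v).
Proof.
move=> r f g; apply/ffunP=> I; rewrite !ffunE.
by rewrite scalerDr !scalerA mulrC.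
Qed.
HB.instance Definition _ x u v :=
  GRing.isLinear.Build R koszul koszul _ (koszul_tr x u v) (koszul_tr_linear x u v).

Definition powers x (u : nat) : 'I_s -> R := fun j => x j ^+ u.

Lemma koszul_d_tr x u v f : (u <= v)%N ->
  koszul_d (powers x v) (koszul_tr x u v f) = koszul_tr x u v (koszul_d (powers x u) f).
Proof.
move=> le_uv; apply/ffunP=> I; rewrite !ffunE scaler_sumr; apply: eq_bigr => j jI.
have eqP : \prod_(k | k \notin j |: I) x k ^+ (v - u) =
           \prod_(k | (k \notin I) && (k != j)) x k ^+ (v - u).
  by apply: eq_bigl => k; rewrite !inE negb_or andbC.
rewrite ffunE !scalerA (bigD1 j jI) eqP /=; congr (_ *: _).
rewrite /powers -[X in x j ^+ X](subnK le_uv) exprD.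
by rewrite [RHS]mulrC -!mulrA [in RHS](mulrCA (x j ^+ u)).
Qed.

Lemma koszul_tr_homog x u v p f : f \in koszul_homog p -> koszul_tr x u v f \in koszul_homog p.
Proof.
by move/koszul_homogP=> hf; apply/koszul_homogP=> J hJ; rewrite ffunE hf ?scaler0.
Qed.

Lemma koszul_tr_cycle x u v p f : (u <= v)%N ->
  f \in koszul_cycle (powers x u) p -> koszul_tr x u v f \in koszul_cycle (powers x v) p.
Proof.
move=> le_uv; rewrite !koszul_cycleE => /andP[hf /eqP df].
by rewrite koszul_tr_homog // koszul_d_tr // df linear0 /=.
Qed.

Definition cycles_tr x u v p (le_uv : (u <= v)%N) (z : koszul_cycles (powers x u) p) :
    koszul_cycles (powers x v) p :=
  KoszulCycle (koszul_tr_cycle le_uv (valP z)).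

Fact cycles_tr_linear x u v p le_uv : linear (@cycles_tr x u v p le_uv).
Proof. by move=> r z w; apply: val_inj; rewrite /= !linearP. Qed.
HB.instance Definition _ x u v p le_uv :=
  GRing.isLinear.Build R (koszul_cycles (powers x u) p) (koszul_cycles (powers x v) p) _
    (@cycles_tr x u v p le_uv) (@cycles_tr_linear x u v p le_uv).

Fact cycles_tr_boundary x u v p (le_uv : (u <= v)%N) z :
  z \in @koszul_boundaries (powers x u) p ->
  cycles_tr le_uv z \in @koszul_boundaries (powers x v) p.
Proof.
rewrite !koszul_boundariesE => /koszul_boundaryP[g hg zg].
apply/koszul_boundaryP; exists (koszul_tr x u v g).
  exact: koszul_tr_homog.
by rewrite koszul_d_tr // -zg.
Qed.

Definition homology_tr x p u v (le_uv : (u <= v)%N) :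
    {linear koszul_homology (powers x u) p -> koszul_homology (powers x v) p} :=
  quotmod_map (@cycles_tr_boundary x u v p le_uv).

Lemma koszul_trxx x u f : koszul_tr x u u f = f.
Proof.
by apply/ffunP=> J; rewrite ffunE subnn big1 ?scale1r // => j _; rewrite expr0.
Qed.

Lemma koszul_tr_comp x u v w f : (u <= v)%N -> (v <= w)%N ->
  koszul_tr x v w (koszul_tr x u v f) = koszul_tr x u w f.
Proof.
move=> uv vw; apply/ffunP=> J; rewrite !ffunE scalerA -big_split /=.
by congr (_ *: _); apply: eq_bigr => j _; rewrite -exprD; congr (_ ^+ _); rewrite addnBA // subnK.
Qed.

Lemma homology_trxx x p u (h : (u <= u)%N) q : homology_tr x p h q = q.
Proof.
rewrite -[q]quotmod_reprK [LHS]quotmod_mapE; congr quotmod_pi; apply: val_inj => /=.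
exact: koszul_trxx.
Qed.

Lemma homology_tr_comp x p u v w (uv : (u <= v)%N) (vw : (v <= w)%N) (uw : (u <= w)%N) q :
  homology_tr x p vw (homology_tr x p uv q) = homology_tr x p uw q.
Proof.
rewrite -[q]quotmod_reprK /homology_tr /= !quotmod_mapE; congr quotmod_pi.
by apply: val_inj => /=; exact: koszul_tr_comp.
Qed.

End Koszul.

Record direct_system (R : pzRingType) := DirectSystem {
  ds_obj : nat -> lmodType R;
  ds_tr : forall u v, (u <= v)%N -> {linear ds_obj u -> ds_obj v};
  ds_trxx : forall u (h : (u <= u)%N) z, ds_tr h z = z;
  ds_tr_comp : forall u v w (uv : (u <= v)%N) (vw : (v <= w)%N) (uw : (u <= w)%N) z,
    ds_tr vw (ds_tr uv z) = ds_tr uw z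
}.

Section DirectLimit.
Variables (R : pzRingType) (D : direct_system R).
Local Notation obj := (ds_obj D).
Local Notation tr := (@ds_tr R D _ _).

Definition dirlim_rel : rel {u : nat & obj u} := fun p q =>
  `[< exists w (hp : (tag p <= w)%N) (hq : (tag q <= w)%N),
        tr hp (tagged p) = tr hq (tagged q) >].

Fact dirlim_rel_equiv : equiv_class_of dirlim_rel.
Proof.
split=> [p|p q|q p r].
- by apply/asboolP; exists (tag p), (leqnn _), (leqnn _).
- by apply/asboolP/asboolP=> -[w [hp [hq e]]]; exists w, hq, hp.
move=> /asboolP[w [hp [hq e]]] /asboolP[w' [hq' [hr e']]]; apply/asboolP.
have hw := leq_maxl w w'; have hw' := leq_maxr w w'.
exists (maxn w w'), (leq_trans hp hw), (leq_trans hr hw').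
rewrite -(ds_tr_comp hp hw) e (ds_tr_comp _ _ (leq_trans hq hw)).
by rewrite -(ds_tr_comp hr hw') -e' (ds_tr_comp _ _ (leq_trans hq hw)).
Qed.
Canonical dirlim_equiv := EquivRelPack dirlim_rel_equiv.
Canonical dirlim_encModRel := defaultEncModRel dirlim_rel.

Definition dirlim : Type := {eq_quot dirlim_rel}.
HB.instance Definition _ := Choice.on dirlim.

Definition dirlim_in (u : nat) (z : obj u) : dirlim :=
  \pi_{eq_quot dirlim_rel} (Tagged obj z).

Lemma dirlim_in_eq u v (z : obj u) (y : obj v) :
  dirlim_in z = dirlim_in y <->
  exists w (hu : (u <= w)%N) (hv : (v <= w)%N), tr hu z = tr hv y.
Proof.
rewrite /dirlim_in; split=> [/eqP|h].
  by rewrite piE => /asboolP.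
by apply/eqP; rewrite piE; apply/asboolP.
Qed.

Lemma dirlim_in_tr u v (h : (u <= v)%N) z : dirlim_in (tr h z) = dirlim_in z.
Proof.
by apply/dirlim_in_eq; exists v, (leqnn v), h; rewrite ds_trxx.
Qed.

Lemma dirlim_in_surj (q : dirlim) : exists u (z : obj u), dirlim_in z = q.
Proof.
exists (tag (repr q)), (tagged (repr q)).
by rewrite /dirlim_in -[RHS]reprK; case: (repr q).
Qed.

Lemma dirlim_in_surj2 (p q : dirlim) :
  exists u (z y : obj u), dirlim_in z = p /\ dirlim_in y = q.
Proof.
have [u [z <-]] := dirlim_in_surj p; have [v [y <-]] := dirlim_in_surj q.
exists (maxn u v), (tr (leq_maxl u v) z), (tr (leq_maxr u v) y).
by rewrite !dirlim_in_tr.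
Qed.

Definition dirlim_scaleadd (r : R) (p q : dirlim) : dirlim :=
  let p' := repr p in let q' := repr q in
  dirlim_in (r *: tr (leq_maxl (tag p') (tag q')) (tagged p')
             + tr (leq_maxr (tag p') (tag q')) (tagged q')).

Lemma dirlim_scaleadd_in r u (z y : obj u) :
  dirlim_scaleadd r (dirlim_in z) (dirlim_in y) = dirlim_in (r *: z + y).
Proof.
rewrite /dirlim_scaleadd; set p := repr _; set q := repr _.
have /dirlim_in_eq[w [hp [hz ez]]] : dirlim_in (tagged p) = dirlim_in z.
  by rewrite -[RHS]reprK -/p /dirlim_in; case: (p).
have /dirlim_in_eq[w' [hq [hy ey]]] : dirlim_in (tagged q) = dirlim_in y.
  by rewrite -[RHS]reprK -/q /dirlim_in; case: (q).
have hw := leq_maxl w w'; have hw' := leq_maxr w w'.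
have hm : (maxn (tag p) (tag q) <= maxn w w')%N.
  by rewrite geq_max (leq_trans hp hw) (leq_trans hq hw').
apply/dirlim_in_eq; exists (maxn w w'), hm, (leq_trans hz hw).
rewrite !linearP /=.
rewrite (ds_tr_comp _ _ (leq_trans hp hw)) (ds_tr_comp _ _ (leq_trans hq hw')).
rewrite -(ds_tr_comp hp hw) ez (ds_tr_comp _ _ (leq_trans hz hw)).
rewrite -(ds_tr_comp hq hw') ey (ds_tr_comp _ _ (leq_trans hz hw)) //.
Qed.

Definition dirlim_zero : dirlim := dirlim_in (0 : obj 0%N).
Definition dirlim_add (p q : dirlim) := dirlim_scaleadd 1 p q.
Definition dirlim_scale (r : R) (p : dirlim) := dirlim_scaleadd r p dirlim_zero.
Definition dirlim_opp (p : dirlim) := dirlim_scale (-1) p.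

Lemma dirlim_zero_in u : dirlim_zero = dirlim_in (0 : obj u).
Proof. by rewrite /dirlim_zero -(dirlim_in_tr (leq0n u)) linear0. Qed.
Lemma dirlim_add_in u (z y : obj u) :
  dirlim_add (dirlim_in z) (dirlim_in y) = dirlim_in (z + y).
Proof. by rewrite /dirlim_add dirlim_scaleadd_in scale1r. Qed.
Lemma dirlim_scale_in r u (z : obj u) :
  dirlim_scale r (dirlim_in z) = dirlim_in (r *: z).
Proof. by rewrite /dirlim_scale (dirlim_zero_in u) dirlim_scaleadd_in addr0. Qed.

Fact dirlim_addA : associative dirlim_add.
Proof.
move=> p q r; have [u [z [y [<- <-]]]] := dirlim_in_surj2 p q.
have [v [x <-]] := dirlim_in_surj r.
have hu := leq_maxl u v; have hv := leq_maxr u v.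
by rewrite -(dirlim_in_tr hu z) -(dirlim_in_tr hu y) -(dirlim_in_tr hv x)
  !dirlim_add_in addrA.
Qed.
Fact dirlim_addC : commutative dirlim_add.
Proof.
move=> p q; have [u [z [y [<- <-]]]] := dirlim_in_surj2 p q.
by rewrite !dirlim_add_in addrC.
Qed.
Fact dirlim_add0 : left_id dirlim_zero dirlim_add.
Proof.
move=> p; have [u [z <-]] := dirlim_in_surj p.
by rewrite (dirlim_zero_in u) dirlim_add_in add0r.
Qed.
Fact dirlim_addN : left_inverse dirlim_zero dirlim_opp dirlim_add.
Proof.
move=> p; have [u [z <-]] := dirlim_in_surj p.
by rewrite (dirlim_zero_in u) /dirlim_opp dirlim_scale_in scaleN1r dirlim_add_in addNr.
Qed.
HB.instance Definition _ := GRing.isZmodule.Build dirlim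
  dirlim_addA dirlim_addC dirlim_add0 dirlim_addN.

Fact dirlim_scalerA r t q : dirlim_scale r (dirlim_scale t q) = dirlim_scale (r * t) q.
Proof.
by have [u [z <-]] := dirlim_in_surj q; rewrite !dirlim_scale_in scalerA.
Qed.
Fact dirlim_scale1r : left_id 1 dirlim_scale.
Proof.
by move=> q; have [u [z <-]] := dirlim_in_surj q; rewrite dirlim_scale_in scale1r.
Qed.
Fact dirlim_scalerDr : right_distributive dirlim_scale +%R.
Proof.
move=> r p q; have [u [z [y [<- <-]]]] := dirlim_in_surj2 p q.
have addE (a b : dirlim) : a + b = dirlim_add a b by [].
by rewrite !addE !(dirlim_scale_in, dirlim_add_in) scalerDr.
Qed.
Fact dirlim_scalerDl q : {morph dirlim_scale^~ q : r t / r + t}.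
Proof.
move=> r t; have [u [z <-]] := dirlim_in_surj q.
by rewrite !dirlim_scale_in [RHS]dirlim_add_in scalerDl.
Qed.
HB.instance Definition _ := GRing.Zmodule_isLmodule.Build R dirlim
  dirlim_scalerA dirlim_scale1r dirlim_scalerDr dirlim_scalerDl.

Fact dirlim_in_linear u : linear (@dirlim_in u).
Proof.
move=> r z y; rewrite [r *: dirlim_in z]dirlim_scale_in.
by rewrite [RHS]dirlim_add_in.
Qed.
HB.instance Definition _ u :=
  GRing.isLinear.Build R (obj u) dirlim _ (@dirlim_in u) (@dirlim_in_linear u).

End DirectLimit.

Section LocalCohomology.
Variables (R : comPzRingType) (M : lmodType R) (s : nat) (x : 'I_s -> R).

(* The exponents u >= 1 are indexed from 0: the u-th module is the homology
   of x_1^(u+1), ..., x_s^(u+1). *)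
Definition koszul_system (i : nat) : direct_system R :=
  @DirectSystem R
    (fun u => koszul_cohomology M (powers x u.+1) i)
    (fun u v (h : (u <= v)%N) => @homology_tr R M s x (s - i) u.+1 v.+1 h)
    (fun u h z => @homology_trxx R M s x (s - i) u.+1 h z)
    (fun u v w uv vw uw z => @homology_tr_comp R M s x (s - i) u.+1 v.+1 w.+1 uv vw uw z).

(* Local cohomology of M with respect to the ideal generated by x. *)
Definition local_cohomology (i : nat) : lmodType R := dirlim (koszul_system i).

(* powers x 1 and x are convertible. *)
Definition lambda (i : nat) :
    {linear koszul_cohomology M x i -> local_cohomology i} :=
  (@dirlim_in R (koszul_system i) 0
    : {linear ds_obj (koszul_system i) 0 -> dirlim (koszul_system i)}).

End LocalCohomology.

(* Main.v *)
(** Write H^i for the local cohomology H^i_a(M). Surjectivity of lambda^i for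
    i < n passes from M to M/yM, for i < n - 1, as soon as y in a is filter
    regular on M: y annihilates Koszul homology, so the obstruction in
    H^(i+1)(x, M) to lifting a class of H^i_a(M/yM) goes to zero in the next
    term. In degree 0 surjectivity says that a annihilates the a-torsion of M.
    Iterating, (iii) implies that every unconditioned filter regular sequence in
    a is weak up to length n, whatever generating set it comes from, which is (i).

    Conversely, if the x_i are weak then a annihilates H^i_a(M) for i < n (by
    induction through M/x_1^u M), so a class of H^i_a(M) comes from
    H^(i-1)_a(M/x_1 M), hence by induction from H^(i-1)(x, M/x_1 M). The image of
    that class in H^i(x, M/(0 : x_1)) lifts to H^i(x, M) because
    (0 : a) meets x_K M trivially when K has at most n elements.

    Finally f-generating sets of any length at least that of a generating set
    exist by prime avoidance, the elements being modified one at a time. *)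

From HB Require Import structures.
From mathcomp Require Import all_boot all_order all_algebra.
From mathcomp Require Import all_classical.
From mathcomp Require Import perm zify.
Require Import Defs.
Set Implicit Arguments.
Unset Strict Implicit.
Unset Printing Implicit Defensive.
Import GRing.Theory.
Local Open Scope classical_set_scope.
Local Open Scope ring_scope.

(** * Submodules, generated ideals and quotients *)

Section Submodules.
Variable R : comPzRingType.

Lemma submoduleP (V : lmodType R) (N : set V) :
  submodule N <-> N 0 /\ forall r u v, N u -> N v -> N (r *: u + v).
Proof.
rewrite /submodule; split=> -[N0 NP]; split.
- by have := N0; rewrite /= inE.
- by move=> r u v Nu Nv; have := NP r u v; rewrite !inE; apply.
- by rewrite inE.
- by move=> r u v; rewrite !inE; apply: NP.
Qed.

Section Closure.
Variables (V : lmodType R) (N : set V).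
Hypothesis subN : submodule N.

Lemma submod0 : N 0. Proof. by case/submoduleP: subN. Qed.
Lemma submodZ r u : N u -> N (r *: u).
Proof. by case/submoduleP: subN => N0 NP Nu; rewrite -[_ *: _]addr0; apply: NP. Qed.
Lemma submodD u v : N u -> N v -> N (u + v).
Proof. by case/submoduleP: subN => _ NP Nu Nv; rewrite -[u]scale1r; apply: NP. Qed.
Lemma submodN u : N u -> N (- u).
Proof. by move=> Nu; rewrite -scaleN1r; apply: submodZ. Qed.
Lemma submodB u v : N u -> N v -> N (u - v).
Proof. by move=> Nu Nv; apply: submodD => //; apply: submodN. Qed.
Lemma submod_sum (I : Type) (l : seq I) (P : pred I) (F : I -> V) :
  (forall i, P i -> N (F i)) -> N (\sum_(i <- l | P i) F i).
Proof. by move=> NF; elim/big_rec: _ => [|i v Pi]; [exact: submod0|apply/submodD/NF]. Qed.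
End Closure.

Lemma span_submodule (V : lmodType R) (G : set V) : submodule (span G).
Proof.
apply/submoduleP; split=> [|r u v Gu Gv] N [subN GN]; first exact: submod0.
have := Gv _ (conj subN GN); have := Gu _ (conj subN GN).
by move=> Nu Nv; apply: submodD => //; apply: submodZ.
Qed.

Lemma sub_span (V : lmodType R) (G : set V) : G `<=` span G.
Proof. by move=> v Gv N [_ /(_ _ Gv)]. Qed.

Lemma span_min (V : lmodType R) (G N : set V) : submodule N -> G `<=` N -> span G `<=` N.
Proof. by move=> subN GN v /(_ _ (conj subN GN)). Qed.

Lemma span_sumP (V : lmodType R) s (m : 'I_s -> V) (P : pred 'I_s) v :
  span [set m j | j in [set j | P j]] v <->
  exists c : 'I_s -> R, v = \sum_(j | P j) c j *: m j.
Proof.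
split=> [|[c ->]]; last first.
  apply: (submod_sum (span_submodule _)) => j Pj.
  by apply: (submodZ (span_submodule _)); apply: sub_span; exists j.
pose N : set V := [set v | exists c : 'I_s -> R, v = \sum_(j | P j) c j *: m j].
apply: (@span_min _ _ N).
  apply/submoduleP; split=> [|r _ _ [c ->] [e ->]].
    by exists (fun=> 0); rewrite big1 // => j _; rewrite scale0r.
  exists (fun j => r * c j + e j); rewrite scaler_sumr -big_split.
  by apply: eq_bigr => j _; rewrite scalerDl scalerA.
move=> _ [j Pj <-]; exists (fun k => (k == j)%:R).
rewrite (bigD1 j) //= eqxx scale1r big1 ?addr0 // => k /andP[_ /negPf->].
by rewrite scale0r.
Qed.

Lemma span_rangeP (V : lmodType R) s (m : 'I_s -> V) v :
  span (range m) v <-> exists c : 'I_s -> R, v = \sum_j c j *: m j.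
Proof.
have -> : range m = [set m j | j in [set j | xpredT j]].
  by congr image; apply/seteqP.
exact: span_sumP.
Qed.

Lemma ideal_gen_rangeP s (x : 'I_s -> R) r :
  ideal_gen (range x) r <-> exists c : 'I_s -> R, r = \sum_j c j * x j.
Proof. exact: (@span_rangeP R^o). Qed.

Lemma gen_in s (x : 'I_s -> R) j : ideal_gen (range x) (x j).
Proof. by apply: (@sub_span R^o); exists j. Qed.

(** The submodule [x_J V], written with module coefficients. Subsets [J] take the place of prefixes
    of a sequence, which makes the order of the elements irrelevant. *)
Definition gensub (V : lmodType R) s (x : 'I_s -> R) (J : {set 'I_s}) : set V :=
  [set v | exists h : 'I_s -> V, v = \sum_(j in J) x j *: h j].
Arguments gensub V {s} x J _.

Lemma gensub_submodule (V : lmodType R) s (x : 'I_s -> R) J : submodule (gensub V x J).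
Proof.
apply/submoduleP; split=> [|r _ _ [h ->] [k ->]].
  by exists (fun=> 0); rewrite big1 // => j _; rewrite scaler0.
exists (fun j => r *: h j + k j); rewrite scaler_sumr -big_split.
by apply: eq_bigr => j _ /=; rewrite scalerDr !scalerA mulrC.
Qed.

Lemma gensub_eq (V : lmodType R) s (x y : 'I_s -> R) (J : {set 'I_s}) :
  {in J, x =1 y} -> gensub V x J = gensub V y J.
Proof.
move=> xy; apply/seteqP; split=> _ [h ->]; exists h;
  by apply: eq_bigr => j jJ; rewrite xy.
Qed.

Lemma gensub0 (V : lmodType R) s (x : 'I_s -> R) v : gensub V x finset.set0 v <-> v = 0.
Proof.
by split=> [[h ->]|->]; [|exists (fun=> 0)]; rewrite big_set0.
Qed.

Lemma gensub_smul (V : lmodType R) s (x : 'I_s -> R) (J : {set 'I_s}) j v :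
  j \in J -> gensub V x J (x j *: v).
Proof.
move=> jJ; exists (fun k => if k == j then v else 0).
rewrite (bigD1 j) //= eqxx big1 ?addr0 // => k /andP[_ /negPf->].
by rewrite scaler0.
Qed.

Lemma gensubU1 (V : lmodType R) s (x : 'I_s -> R) (J : {set 'I_s}) i v : i \notin J ->
  gensub V x (i |: J) v <-> exists2 u, gensub V x J u & exists m, v = u + x i *: m.
Proof.
move=> iJ; split=> [[h ->]|[_ [h ->] [m ->]]].
  rewrite big_setU1 //=; exists (\sum_(j in J) x j *: h j); first by exists h.
  by exists (h i); rewrite addrC.
apply: submodD; first exact: gensub_submodule.
  apply: submod_sum => [|j jJ]; first exact: gensub_submodule.
  by apply: gensub_smul; rewrite !inE jJ orbT.
by apply: gensub_smul; rewrite !inE eqxx.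
Qed.

Lemma gensubS (V : lmodType R) s (x : 'I_s -> R) (J L : {set 'I_s}) :
  J \subset L -> gensub V x J `<=` gensub V x L.
Proof.
move=> /fintype.subsetP JL _ [h ->]; apply: submod_sum => [|j jJ]; first exact: gensub_submodule.
by apply: gensub_smul; apply: JL.
Qed.

Lemma smul_ideal_gen (V : lmodType R) s (x : 'I_s -> R) (J : {set 'I_s}) :
  smul (ideal_gen [set x j | j in [set j | j \in J]]) setT = gensub V x J.
Proof.
apply/seteqP; split.
  apply: span_min; first exact: gensub_submodule.
  move=> _ [r /(@span_sumP R^o s x (mem J))[c ->] [m _ <-]].
  rewrite scaler_suml; apply: submod_sum => [|j jJ]; first exact: gensub_submodule.
  by rewrite [c j *: _]mulrC -scalerA; apply: gensub_smul.
move=> _ [h ->]; apply: submod_sum => [|j jJ]; first exact: span_submodule.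
apply: sub_span; exists (x j); first by apply: (@sub_span R^o); exists j.
by exists (h j).
Qed.

Lemma prefix_gensub (V : lmodType R) r s (x : 'I_s -> R) (f : 'I_r -> 'I_s) (i : 'I_r) :
  @prefix_submod R V _ (fun k => x (f k)) i =
  gensub V x [set f j | j : 'I_r & (j < i)%N]%SET.
Proof.
rewrite -smul_ideal_gen /prefix_submod; congr (smul (ideal_gen _) _).
apply/seteqP; split=> [_ [j /= ji <-]|_ [_ /= /imsetP[j + ->] <-]].
  by exists (f j) => //=; apply: imset_f; rewrite inE.
by rewrite inE => ji; exists j.
Qed.

Lemma gensub_imset (V : lmodType R) r s (x : 'I_s -> R) (f : 'I_r -> 'I_s)
  (J : {set 'I_r}) :
  injective f -> gensub V (fun k => x (f k)) J = gensub V x (f @: J).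
Proof.
move=> injf; apply/seteqP; split=> _ [h ->].
  apply: submod_sum => [|j jJ]; first exact: gensub_submodule.
  by apply: gensub_smul; apply: imset_f.
apply: submod_sum => [|_ /imsetP[j jJ ->]]; first exact: gensub_submodule.
exact: (@gensub_smul _ _ (fun k => x (f k))).
Qed.

(** From here on a quotient is known only through a surjection and its kernel, so that iterated
    quotients can be treated as quotients of the original module. *)
Lemma quotient_exists (V : lmodType R) (N : set V) : submodule N ->
  exists (Q : lmodType R) (pi : {linear V -> Q}),
    (forall q, exists v, pi v = q) /\ forall v, pi v = 0 <-> N v.
Proof.
move=> subN.
pose S : submodClosed V :=
  HB.pack ([in N] : {pred V}) (GRing.isSubmodClosed.Build R V [in N] (subN : GRing.submod_closed _)).
exists (quotmod S), (quotmod_pi S : {linear V -> quotmod S}); split=> [q|v].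
  by exists (quotmod_repr q); apply: quotmod_reprK.
rewrite -(linear0 (quotmod_pi S)).
have /= := quotmod_piP S v 0; rewrite subr0 => ->.
by rewrite /S /= inE.
Qed.

End Submodules.
Arguments gensub {R} V {s} x J _.

(** * Torsion and filter regular elements *)

Section Torsion.
Variables (R : comPzRingType) (s : nat) (x : 'I_s -> R) (V : lmodType R).
Local Notation a := (ideal_gen (range x)).

(** The preimage in [V] of the [a]-torsion submodule of [V/N]. *)
Definition torsion (N : set V) : set V := \bigcup_t colon N (idealX a t).

(** For a submodule [N] this means that [y] is a nonzerodivisor on [V / torsion N]. *)
Definition filter_nzd (N : set V) (y : R) : Prop := colon_elt N y `<=` torsion N.

Lemma idealXS t r b : a r -> idealX a t b -> idealX a t.+1 (r * b).
Proof. by move=> ar tb; apply: (@sub_span R R^o); exists r => //; exists b. Qed.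

Lemma idealX_submodule t : ideal (idealX a t).
Proof. by case: t => [|t]; [apply/submoduleP|apply: (@span_submodule R R^o)]. Qed.

Lemma exp_idealX t r : a r -> idealX a t (r ^+ t).
Proof. by move=> ar; elim: t => // t IH; rewrite exprS; apply: idealXS. Qed.

Lemma idealXW t u : (t <= u)%N -> idealX a u `<=` idealX a t.
Proof.
move=> /subnK<-; elim: (u - t)%N => // k IH; apply: subset_trans IH.
apply: (@span_min R R^o); first exact: idealX_submodule.
by move=> _ [r ar [b kb <-]]; apply: (submodZ (idealX_submodule _) r kb).
Qed.

Lemma colon_idealXW (N : set V) t u : (t <= u)%N ->
  colon N (idealX a t) `<=` colon N (idealX a u).
Proof. by move=> /idealXW tu m Nm r /tu; apply: Nm. Qed.

Lemma colonS (N : set V) t m : submodule N ->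
  (forall j b, idealX a t b -> N (b *: (x j *: m))) -> colon N (idealX a t.+1) m.
Proof.
move=> subN Nm; apply: (@span_min R R^o _ [set b | N (b *: m)]).
  apply/submoduleP; split=> [|r u v Nu Nv]; first by rewrite /= scale0r; apply: submod0.
  by rewrite /= scalerDl -scalerA; apply: submodD => //; apply: submodZ.
move=> _ [r /ideal_gen_rangeP[c ->] [b tb <-]].
rewrite /= -[_ *: b]/(_ * b) mulr_suml scaler_suml; apply: submod_sum => // j _.
rewrite -mulrA -scalerA; apply: submodZ => //.
by rewrite mulrC -scalerA; apply: Nm.
Qed.

Section Submodule.
Variable N : set V.
Hypothesis subN : submodule N.

Lemma sub_torsion : N `<=` torsion N.
Proof. by move=> m Nm; exists 0%N => // r _; apply: submodZ. Qed.

Lemma torsion_submodule : submodule (torsion N).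
Proof.
apply/submoduleP; split=> [|r u v [t _ tu] [w _ wv]]; first by apply: sub_torsion; apply: submod0.
exists (maxn t w) => // b tb; rewrite scalerDr scalerA mulrC -scalerA.
apply: submodD => //; first by apply: submodZ => //; exact: (colon_idealXW (leq_maxl t w) tu).
exact: (colon_idealXW (leq_maxr t w) wv).
Qed.

(** The generators are finitely many, so the largest of their exponents plus one works for [m]. *)
Lemma torsion_gen m : (forall j, torsion N (x j *: m)) -> torsion N m.
Proof.
move=> tm; have /choice[t {}tm] j : exists t, colon N (idealX a t) (x j *: m).
  by have [t] := tm j; exists t.
exists (\max_j t j).+1 => //; apply: colonS => // j b.
exact: (colon_idealXW (leq_bigmax j) (tm j)).
Qed.

(** The quotient [V / torsion N] is torsion-free: peel off one factor of [a^t] at a time. *)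
Lemma torsion_closed t m :
  (forall b, idealX a t b -> torsion N (b *: m)) -> torsion N m.
Proof.
elim: t m => [|t IH] m tm; first by rewrite -[m]scale1r; apply: tm.
apply: torsion_gen => j; apply: IH => b tb.
by rewrite scalerA mulrC; apply: tm; apply: idealXS tb; apply: gen_in.
Qed.

Lemma filter_nzd_torsion y m : filter_nzd N y -> torsion N (y *: m) -> torsion N m.
Proof.
move=> Ny [t _ tm]; apply: (@torsion_closed t) => b tb; apply: Ny.
by rewrite /colon_elt /= scalerA mulrC -scalerA; apply: tm.
Qed.

Lemma filter_nzd_exp y n : filter_nzd N y -> filter_nzd N (y ^+ n).
Proof.
move=> Ny; elim: n => [|n IH] m; rewrite /colon_elt /=.
  by rewrite expr0 scale1r; apply: sub_torsion.
by rewrite exprSr -scalerA => /IH; apply: filter_nzd_torsion.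
Qed.

End Submodule.

Lemma torsionS (N N' : set V) : N `<=` N' -> torsion N `<=` torsion N'.
Proof. by move=> NN' m [t _ tm]; exists t => // b tb; apply/NN'/tm. Qed.

Lemma torsionZ (N N' : set V) y m :
  (forall u, N u -> N' (y *: u)) -> torsion N m -> torsion N' (y *: m).
Proof.
move=> NN' [t _ tm]; exists t => // b tb.
by rewrite scalerA mulrC -scalerA; apply/NN'/tm.
Qed.

Definition add_multiples (N : set V) (y : R) : set V :=
  [set m | exists2 u, N u & exists v, m = u + y *: v].

Section AddMultiples.
Variable N : set V.
Hypothesis subN : submodule N.

Lemma add_multiples_submodule y : submodule (add_multiples N y).
Proof.
apply/submoduleP; split=> [|r _ _ [u Nu [v ->]] [u' Nu' [v' ->]]].
  by exists 0; [exact: submod0|exists 0; rewrite scaler0 addr0].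
exists (r *: u + u'); first by apply: submodD => //; apply: submodZ.
exists (r *: v + v').
by rewrite !scalerDr !scalerA (mulrC r) addrACA.
Qed.

Lemma add_multiplesl y u : N u -> add_multiples N y u.
Proof. by move=> Nu; exists u => //; exists 0; rewrite scaler0 addr0. Qed.

Lemma add_multiplesr y v : add_multiples N y (y *: v).
Proof. by exists 0; [exact: submod0|exists v; rewrite add0r]. Qed.

(* Permutability: in a local ring this is the exchange of two consecutive
   elements of a regular sequence. *)
Lemma filter_nzd_swap y z : filter_nzd N y ->
  filter_nzd (add_multiples N y) z -> filter_nzd (add_multiples N z) y.
Proof.
move=> Ny Nyz m [n Nn [m' ym]].
have subNz := add_multiples_submodule z.
have [t _ tm'] : torsion (add_multiples N y) m'.
  apply: Nyz; exists (- n); first exact: submodN.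
  by exists m; rewrite ym addKr.
apply: (torsion_closed subNz (t := t)) => b tb.
have [n' Nn' [m'' bm']] := tm' b tb.
have /Ny tN : N (y *: (b *: m - z *: m'')).
  rewrite scalerBr scalerA mulrC -scalerA ym scalerDr.
  rewrite [b *: (z *: m')]scalerA mulrC -scalerA bm' scalerDr.
  rewrite [y *: (z *: _)]scalerA [y * z]mulrC -[(z * y) *: _]scalerA.
  by rewrite addrA addrK; apply: submodD => //; apply: submodZ.
rewrite -[b *: m](subrK (z *: m'')).
apply: (submodD (torsion_submodule subNz)).
  by apply: torsionS tN => u; apply: add_multiplesl.
by apply: sub_torsion => //; apply: add_multiplesr.
Qed.

(** Induction on the exponent. If [z m] lies in [N + y^(n+1) V], then up to torsion [m = y m1]
    modulo [N]. Cancelling [y], up to torsion again, puts [z m1] in [N + y^n V]; so [m1] is torsion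
    modulo [y^n], and [y m1] modulo [y^(n+1)]. *)
Lemma filter_nzd_add_exp y z n : filter_nzd N y ->
  filter_nzd (add_multiples N y) z -> filter_nzd (add_multiples N (y ^+ n)) z.
Proof.
move=> Ny Nyz; elim: n => [|n IH] m.
  move=> _; apply: sub_torsion; first exact: add_multiples_submodule.
  by rewrite expr0 -[m]scale1r; apply: add_multiplesr.
move=> [u Nu [m' zm]]; have subNn := add_multiples_submodule (y ^+ n.+1).
have [t _ tm] : torsion (add_multiples N y) m.
  by apply: Nyz; exists u => //; exists (y ^+ n *: m'); rewrite scalerA -exprS.
apply: (torsion_closed subNn (t := t)) => b tb.
have [v Nv [m1 bm]] := tm b tb.
have tN : torsion N (z *: m1 - y ^+ n *: (b *: m')).
  apply: Ny; rewrite /colon_elt /= scalerBr.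
  rewrite [y *: (z *: _)]scalerA [y * z]mulrC -scalerA.
  have -> : y *: m1 = b *: m - v by rewrite bm addrC addKr.
  rewrite scalerBr [z *: (b *: m)]scalerA mulrC -scalerA zm.
  rewrite scalerDr [y *: (y ^+ n *: _)]scalerA -exprS.
  rewrite [b *: (y ^+ _ *: _)]scalerA [b * _]mulrC -scalerA.
  by rewrite addrAC addrK; apply: submodB => //; apply: submodZ.
have subn := add_multiples_submodule (y ^+ n).
have tm1 : torsion (add_multiples N (y ^+ n)) m1.
  apply: (filter_nzd_torsion subn IH).
  rewrite -[z *: m1](subrK (y ^+ n *: (b *: m'))).
  apply: (submodD (torsion_submodule subn)).
    by apply: torsionS tN => w; apply: add_multiplesl.
  by apply: sub_torsion => //; apply: add_multiplesr.
rewrite bm; apply: (submodD (torsion_submodule subNn)).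
  by apply: sub_torsion => //; apply: add_multiplesl.
apply: torsionZ tm1 => _ [w Nw [w' ->]].
rewrite scalerDr scalerA -exprS.
apply: submodD => //; last exact: add_multiplesr.
by apply: add_multiplesl; apply: submodZ.
Qed.

End AddMultiples.
End Torsion.

(** * Koszul chains *)

Section KoszulCalculus.
Variables (R : comPzRingType) (s : nat).
Implicit Types (x : 'I_s -> R) (M Q : lmodType R) (p : nat).

(** A chain of degree 0 has zero differential, so the value [0.-1 = 0] is harmless. *)
Lemma koszul_d_homog M x p (f : koszul M s) :
  f \in koszul_homog p -> koszul_d x f \in koszul_homog p.-1.
Proof.
move=> /koszul_homogP hf; apply/koszul_homogP => I hI; rewrite ffunE big1 // => j jI.
by rewrite hf ?scaler0 // cardsU1 jI add1n; apply: contraNneq hI => <-.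
Qed.

(** Left exterior multiplication by [e_k]; the sign moves [e_k] to its place in [e_J]. *)
Definition koszul_wedge M (k : 'I_s) (f : koszul M s) : koszul M s :=
  [ffun J : {set 'I_s} => if k \in J
     then (-1) ^+ #|[pred i in J | (i < k)%N]| *: f (J :\ k)%SET else 0].

Lemma koszul_wedge_homog M k p (f : koszul M s) :
  f \in koszul_homog p -> koszul_wedge k f \in koszul_homog p.+1.
Proof.
move=> /koszul_homogP hf; apply/koszul_homogP => J hJ; rewrite ffunE.
case: ifP => // kJ; rewrite hf ?scaler0 //.
by apply: contraNneq hJ => <-; rewrite (cardsD1 k J) kJ.
Qed.

Lemma card_lt_setU1 (I : {set 'I_s}) (j k : 'I_s) : j \notin I ->
  #|[pred i in j |: I | (i < k)%N]| = (#|[pred i in I | (i < k)%N]| + (j < k))%N.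
Proof.
move=> jI; case: ltnP => jk; last first.
  rewrite addn0; apply: eq_card => i; rewrite !inE; case: (eqVneq i j) => //= ->.
  by rewrite ltnNge jk andbF.
rewrite (cardD1 j) !inE eqxx jk /= addnC; congr (_ + _)%N.
by apply: eq_card => i; rewrite !inE; case: (eqVneq i j) => //= ->; rewrite (negPf jI).
Qed.

(** Exterior multiplication by [e_k] is a homotopy from multiplication by [x_k] to zero; this is why
    the [x_k] annihilate Koszul homology. *)
Lemma koszul_wedge_homotopy M x k (f : koszul M s) :
  koszul_d x (koszul_wedge k f) + koszul_wedge k (koszul_d x f) = x k *: f.
Proof.
have sqr_sgn n : (-1) ^+ n * (-1) ^+ n = 1 :> R.
  by rewrite -exprMn mulN1r opprK expr1n.
apply/ffunP=> I; rewrite !ffunE; case: ifP => [kI|/negbT kI]; last first.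
  rewrite addr0 (bigD1 k kI) /= ffunE !inE eqxx /= big1 => [|j /andP[jI jk]].
    rewrite addr0 scalerA mulrAC card_lt_setU1 // ltnn addn0 sqr_sgn mul1r.
    by rewrite setU1K.
  by rewrite ffunE !inE (negPf kI) eq_sym (negPf jk) scaler0.
have [I' kI' ->] : exists2 I' : {set 'I_s}, k \notin I' & I = k |: I'.
  by exists (I :\ k)%SET; [rewrite finset.setD11 | rewrite finset.setD1K].
rewrite setU1K // scaler_sumr [X in _ + X](bigD1 k kI') /=.
rewrite addrCA -[RHS]addr0; congr (_ + _).
  by rewrite scalerA mulrA card_lt_setU1 // ltnn addn0 sqr_sgn mul1r.
have eqI j : (j \notin k |: I') = (j \notin I') && (j != k).
  by rewrite !inE negb_or andbC.
rewrite (eq_bigl _ _ eqI) -big_split big1 //= => j /andP[jI' jk].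
rewrite ffunE !inE eqxx orbT.
have -> : ((j |: (k |: I')) :\ k = j |: I')%SET.
  by rewrite finset.setUCA setU1K // !inE negb_or eq_sym jk.
rewrite !scalerA -scalerDl !card_lt_setU1 ?eqI ?jI' // !ltnn !addn0 !exprD.
(* The terms with [j != k] cancel in pairs, since exactly one of [j < k] and [k < j] holds. *)
suff -> : (-1) ^+ (j < k)%N = - (-1) ^+ (k < j)%N :> R.
  by rewrite !mulrN [_ * x j]mulrAC mulrACA sqr_sgn mulr1 mulrC addNr scale0r.
by case: ltngtP jk => [||/val_inj->]; rewrite ?eqxx // ?opprK ?expr1 ?expr0.
Qed.

Lemma koszul_wedge_d M x k p (f : koszul M s) : f \in koszul_cycle x p ->
  x k *: f = koszul_d x (koszul_wedge k f).
Proof.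
rewrite koszul_cycleE => /andP[_ /eqP df].
rewrite -koszul_wedge_homotopy df [X in _ + X](_ : _ = 0) ?addr0 //.
by apply/ffunP=> J; rewrite !ffunE scaler0 if_same.
Qed.

(** Below the top degree every [J] misses some index [j], so one transition step multiplies [f J] by
    some [x_j]. Thus identities that hold only up to elements killed by [a] become exact one step
    later in the direct system. *)
Lemma koszul_tr_torsion M x u p (f : koszul M s) :
  (p < s)%N -> f \in koszul_homog p -> (forall J j, x j *: f J = 0) ->
  koszul_tr x u u.+1 f = 0.
Proof.
move=> ps /koszul_homogP hf xf; apply/ffunP => J; rewrite !ffunE.
have [cJ|/hf->] := eqVneq #|J| p; last by rewrite scaler0.
have [j /= jJ|J_] := pickP [pred j | j \notin J].
  by rewrite (bigD1 j jJ) /= subSnn expr1 mulrC -scalerA xf scaler0.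
suff JT : J = finset.setT by move: ps; rewrite -cJ JT cardsT card_ord ltnn.
by apply/finset.setP => j; rewrite inE; have := J_ j => /= /negbFE.
Qed.

Definition koszul_map M Q (pi : {linear M -> Q}) (f : koszul M s) : koszul Q s :=
  [ffun J => pi (f J)].

Section Map.
Variables (M Q : lmodType R) (pi : {linear M -> Q}).
Implicit Types (f : koszul M s).

Lemma koszul_mapD f g : koszul_map pi (f + g) = koszul_map pi f + koszul_map pi g.
Proof. by apply/ffunP => J; rewrite !ffunE linearD. Qed.

Lemma koszul_mapZ r f : koszul_map pi (r *: f) = r *: koszul_map pi f.
Proof. by apply/ffunP => J; rewrite !ffunE linearZ. Qed.

Lemma koszul_map_homog p f :
  f \in koszul_homog p -> koszul_map pi f \in koszul_homog p.
Proof.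
by move=> /koszul_homogP hf; apply/koszul_homogP => J hJ; rewrite ffunE hf ?linear0.
Qed.

Lemma koszul_map_d x f : koszul_map pi (koszul_d x f) = koszul_d x (koszul_map pi f).
Proof.
apply/ffunP => I; rewrite !ffunE linear_sum; apply: eq_bigr => j _.
by rewrite linearZ ffunE.
Qed.

Lemma koszul_map_tr x u v f :
  koszul_map pi (koszul_tr x u v f) = koszul_tr x u v (koszul_map pi f).
Proof. by apply/ffunP => I; rewrite !ffunE linearZ. Qed.

Lemma koszul_map_surj p (g : koszul Q s) :
  (forall q, exists m, pi m = q) -> g \in koszul_homog p ->
  exists2 f, f \in koszul_homog p & koszul_map pi f = g.
Proof.
move=> /choice[sec piK] /koszul_homogP hg.
exists [ffun J : {set 'I_s} => if #|J| == p then sec (g J) else 0].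
  by apply/koszul_homogP => J hJ; rewrite ffunE (negPf hJ).
apply/ffunP => J; rewrite !ffunE; case: eqP => [_|/eqP/hg->]; first exact: piK.
by rewrite linear0.
Qed.

Lemma koszul_map_ker p y f :
  (forall m, pi m = 0 <-> exists v, m = y *: v) -> f \in koszul_homog p ->
  koszul_map pi f = 0 -> exists2 k, k \in koszul_homog p & f = y *: k.
Proof.
move=> ker /koszul_homogP hf /ffunP f0.
have /choice[k fk] J : exists v, f J = y *: v by apply/ker; have := f0 J; rewrite !ffunE.
exists [ffun J : {set 'I_s} => if #|J| == p then k J else 0].
  by apply/koszul_homogP => J hJ; rewrite ffunE (negPf hJ).
by apply/ffunP => J; rewrite !ffunE; case: eqP => [_|/eqP/hf->]; rewrite ?scaler0.
Qed.

End Map.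
End KoszulCalculus.

(** * Lifting local cohomology classes to Koszul homology *)

Section Lifts.
Variables (R : comPzRingType) (s : nat) (x : 'I_s -> R).
Implicit Types (M Q : lmodType R) (p : nat).
Local Notation d u := (koszul_d (powers x u)).
Local Notation tr := (koszul_tr x).
Local Notation Z u := (koszul_cycle (powers x u)).

(* With i = s - p, this is the surjectivity of H^i(x, M) -> H^i_a(M). *)
Definition koszul_lifts M p := forall u (f : koszul M s),
  (0 < u)%N -> f \in Z u p ->
  exists v (g h : koszul M s), [/\ (u <= v)%N, g \in Z 1 p, h \in koszul_homog p.+1
    & tr u v f = tr 1 v g + d v h].

(* With i = s - p, this says that H^i_a(M) is annihilated by a. *)
Definition koszul_killed M p := forall u (f : koszul M s) j,
  (0 < u)%N -> f \in Z u p ->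
  exists v (h : koszul M s), [/\ (u <= v)%N, h \in koszul_homog p.+1
    & x j *: tr u v f = d v h].

Lemma koszul_map_multiple M Q (pi : {linear M -> Q}) y (f : koszul M s) :
  (forall m, pi m = 0 <-> exists v, m = y *: v) -> koszul_map pi (y *: f) = 0.
Proof.
by move=> ker; apply/ffunP => J; rewrite !ffunE; apply/ker; exists (f J).
Qed.

(** Any element of the ideal kills Koszul homology; the primitive is the same combination of the
    homotopies [koszul_wedge j]. *)
Lemma cycle_multiple M (c : 'I_s -> R) p (g : koszul M s) : g \in Z 1 p ->
  exists2 e, e \in koszul_homog p.+1 & d 1 e = (\sum_j c j * x j) *: g.
Proof.
move=> gZ; have := gZ; rewrite koszul_cycleE => /andP[gH _].
exists (\sum_j c j *: koszul_wedge j g).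
  by apply: rpred_sum => j _; apply/rpredZ/koszul_wedge_homog.
rewrite linear_sum scaler_suml; apply: eq_bigr => j _.
by rewrite linearZ /= -(koszul_wedge_d _ gZ) scalerA.
Qed.

(* A chase along the connecting map H^i(M/yM) -> H^(i+1)(M): the class of the
   obstruction k to lifting a cycle comes from H^(i+1)(x, M), which y kills. *)
Lemma koszul_lifts_quotient M Q (pi : {linear M -> Q}) (c : 'I_s -> R) y p :
  y = \sum_j c j * x j -> (forall m : M, y *: m = 0 -> forall j, x j *: m = 0) ->
  (forall q, exists m, pi m = q) -> (forall m, pi m = 0 <-> exists v, m = y *: v) ->
  (p < s)%N -> koszul_lifts M p.+1 -> koszul_lifts M p -> koszul_lifts Q p.+1.
Proof.
move=> yE ytor pisurj piker ps liftM1 liftM u fb u0.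
rewrite koszul_cycleE => /andP[fbH /eqP dfb].
have [f fH fE] := koszul_map_surj pisurj fbH.
have [k kH dfE] : exists2 k, k \in koszul_homog p & d u f = y *: k.
  apply: (koszul_map_ker piker); first exact: (koszul_d_homog _ fH).
  by rewrite koszul_map_d fE.
(* Here [k] need not be a cycle, but [y] kills [dk] because [y dk = ddf = 0]. Hence all [x_j] kill
   [dk], and one transition removes it. *)
have trk0 : tr u u.+1 (d u k) = 0.
  apply: koszul_tr_torsion (koszul_d_homog _ kH) _; first exact: leq_ltn_trans (leq_pred _) ps.
  move=> J j; apply: ytor; have /ffunP/(_ J) := koszul_dd (powers x u) f.
  by rewrite dfE linearZ !ffunE.
have trkZ : tr u u.+1 k \in Z u.+1 p.
  by rewrite koszul_cycleE koszul_tr_homog // koszul_d_tr // trk0 eqxx.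
have [v [g [h [uv gZ hH trk]]]] := liftM _ _ (ltn0Sn _) trkZ.
have u_v := ltnW uv; have v_gt0 := ltn_trans u0 uv.
have [e eH de] := cycle_multiple c gZ.
rewrite -yE in de.
(* The differential of [tr u v f] is [y] times [tr 1 v g + d v h]. Subtracting the primitive [e] of
   [y g] and the chain [y h] leaves a cycle over [M]; modulo [y] only [e] remains as a
   correction. *)
have [f1 f1Z fE1] : exists2 f1, f1 \in Z v p.+1 & tr u v f = f1 + y *: h + tr 1 v e.
  exists (tr u v f - tr 1 v e - y *: h); last by rewrite !subrK.
  rewrite koszul_cycleE rpredB ?rpredZ ?rpredB ?koszul_tr_homog //=.
  rewrite !linearB !linearZ /= !koszul_d_tr // dfE de !linearZ /=.
  by rewrite -(koszul_tr_comp _ _ (leqnSn u) uv) trk -!scalerDr -addrA -opprD subrr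
    scaler0.
have [w [g' [h' [vw g'Z h'H trf1]]]] := liftM1 _ _ v_gt0 f1Z.
have trf : tr u w f = tr 1 w (e + g') + d w h' + y *: tr v w h.
  rewrite -(koszul_tr_comp _ _ u_v vw) fE1 !linearD linearZ /= trf1.
  by rewrite koszul_tr_comp // [in RHS](addrC (tr 1 w e)) addrAC; congr (_ + _); rewrite addrAC.
exists w, (koszul_map pi (e + g')), (koszul_map pi h'); split.
- exact: leq_trans vw.
- move: g'Z; rewrite !koszul_cycleE => /andP[g'H /eqP dg'].
  rewrite koszul_map_homog ?rpredD //= -koszul_map_d linearD /= de dg' koszul_mapD.
  rewrite koszul_map_multiple // add0r.
  by apply/eqP/ffunP => J; rewrite !ffunE linear0.
- exact: koszul_map_homog.
- rewrite -fE -koszul_map_tr trf -koszul_map_tr -koszul_map_d -koszul_mapD.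
  by rewrite koszul_mapD koszul_map_multiple // addr0.
Qed.

(** A cycle [f] of [K(x^u, M)] satisfies [x_i^u f = d e] with [e = e_i /\ f], and [e] is a cycle
    modulo [x_i^u]. If [x_j e = d h + x_i^u k] at a later stage, applying [d] gives
    [x_i^u (x_j f - d k) = 0], so the bracket vanishes after one more transition. As [u] depends on
    [f], all quotients by powers of [x_i] are needed. *)
Lemma koszul_killed_quotient M (i : 'I_s) p :
  (forall u (m : M), x i ^+ u *: m = 0 -> forall j, x j *: m = 0) ->
  (forall u, (0 < u)%N -> exists (Q : lmodType R) (pi : {linear M -> Q}),
     [/\ forall q, exists m, pi m = q,
         forall m, pi m = 0 <-> exists v, m = x i ^+ u *: v
       & koszul_killed Q p.+1]) ->
  (p < s)%N -> koszul_killed M p.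
Proof.
move=> xtor killQ ps u f j u0 fZ.
have := fZ; rewrite koszul_cycleE => /andP[fH /eqP df].
have [Q [pi [pisurj piker kill]]] := killQ u u0.
have ef := koszul_wedge_d i fZ; set e := koszul_wedge i f in ef.
have eH : e \in koszul_homog p.+1 by apply: koszul_wedge_homog.
have peZ : koszul_map pi e \in Z u p.+1.
  by rewrite koszul_cycleE koszul_map_homog //= -koszul_map_d -ef koszul_map_multiple.
have [v [hb [uv hbH hbE]]] := kill _ _ j u0 peZ.
have [h hH hE] := koszul_map_surj pisurj hbH.
have [k kH kE] : exists2 k, k \in koszul_homog p.+1 &
    x j *: tr u v e - d v h = x i ^+ u *: k.
  apply: (koszul_map_ker piker).
    by rewrite rpredB ?rpredZ ?koszul_tr_homog //; apply: (koszul_d_homog _ hH).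
  rewrite -scaleN1r koszul_mapD !koszul_mapZ koszul_map_tr koszul_map_d hE hbE.
  by rewrite scaleN1r subrr.
have dkE : x i ^+ u *: (x j *: tr u v f - d v k) = 0.
  rewrite scalerBr scalerA mulrC -scalerA -[x i ^+ u *: tr u v f]linearZ /= ef.
  rewrite -koszul_d_tr // -[x i ^+ u *: d v k]linearZ -[x j *: d v _]linearZ /=.
  by rewrite -kE linearB /= koszul_dd subr0 subrr.
exists v.+1, (tr v v.+1 k); split; [exact: leqW|exact: koszul_tr_homog|].
rewrite koszul_d_tr // -(koszul_tr_comp _ _ uv (leqnSn v)) -linearZ /=.
apply/eqP; rewrite -subr_eq0 -linearB /=; apply/eqP.
apply: (koszul_tr_torsion _ ps).
  by rewrite rpredB ?rpredZ ?koszul_tr_homog //; apply: (koszul_d_homog _ kH).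
by move=> J; apply: (xtor u); move/ffunP: dkE => /(_ J); rewrite !ffunE.
Qed.

(** Since the limit class is killed by [x_i], one may write [x_i f = d e] at a later stage, with [e]
    a cycle modulo [x_i]. Lifting its class gives [e = g + d h + x_i k] up to transition maps, with
    [d g = x_i c]. Then [c] lifts the class of [f]: the difference [f - c - d k] is killed by [x_i]
    and dies at the next stage. *)
Lemma koszul_lifts_step M Q (pi : {linear M -> Q}) (i : 'I_s) p :
  (forall m : M, x i *: m = 0 -> forall j, x j *: m = 0) ->
  (forall q, exists m, pi m = q) -> (forall m, pi m = 0 <-> exists v, m = x i *: v) ->
  (forall (I : {set 'I_s}) m, #|I|.+1 = p -> gensub M x (~: I)%SET m ->
     (forall j, x j *: m = 0) -> m = 0) ->
  (0 < p < s)%N -> koszul_killed M p -> koszul_lifts Q p.+1 -> koszul_lifts M p.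
Proof.
move=> xtor pisurj piker inter0 /andP[p_gt0 ps] killM liftQ u0 f0 u0_gt0 f0Z.
have [u [e [u0u eH eE]]] := killM _ _ i u0_gt0 f0Z.
have u_gt0 := leq_trans u0_gt0 u0u.
move: eE (koszul_tr_cycle u0u f0Z); move fE: (tr u0 u f0) => f eE.
rewrite koszul_cycleE => /andP[fH /eqP df].
have peZ : koszul_map pi e \in Z u p.+1.
  by rewrite koszul_cycleE koszul_map_homog //= -koszul_map_d -eE koszul_map_multiple.
have [v [gb [hb [uv gbZ hbH trE]]]] := liftQ _ _ u_gt0 peZ.
have v_gt0 := leq_trans u_gt0 uv.
move: gbZ; rewrite koszul_cycleE => /andP[gbH /eqP dgb].
have [g gH gE] := koszul_map_surj pisurj gbH.
have [h hH hE] := koszul_map_surj pisurj hbH.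
have [k kH kE] : exists2 k, k \in koszul_homog p.+1 &
    tr u v e - tr 1 v g - d v h = x i *: k.
  apply: (koszul_map_ker piker).
    by rewrite !rpredB ?koszul_tr_homog //; apply: (koszul_d_homog _ hH).
  rewrite -!scaleN1r !koszul_mapD !koszul_mapZ !koszul_map_tr koszul_map_d gE hE trE.
  by rewrite !scaleN1r addrAC addrK subrr.
have [c cH cE] : exists2 c, c \in koszul_homog p & d 1 g = x i *: c.
  apply: (koszul_map_ker piker); first exact: (koszul_d_homog _ gH).
  by rewrite koszul_map_d gE.
(* From [x_i dc = ddg = 0], each coordinate of [dc] is killed by [a]. The coordinate at [I] is a
   combination of the [x_j] with [j] outside [I], so [inter0] forces it to vanish. *)
have dc : d 1 c = 0.
  have dcH := koszul_d_homog (powers x 1) cH; apply/ffunP => I.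
  rewrite [RHS]ffunE; have [cI|/(koszul_homogP _ _ dcH)//] := eqVneq #|I| p.-1.
  apply: (inter0 I); first by rewrite cI prednK.
    rewrite ffunE; apply: submod_sum => [|j jI]; first exact: gensub_submodule.
    rewrite /powers expr1 mulrC -scalerA; apply: gensub_smul.
    by rewrite finset.in_setC.
  move=> j; apply: xtor; have /ffunP/(_ I) := koszul_dd (powers x 1) g.
  by rewrite cE linearZ !ffunE.
exists v.+1, c, (tr v v.+1 k); split.
- by rewrite leqW // (leq_trans u0u).
- by rewrite koszul_cycleE cH dc eqxx.
- exact: koszul_tr_homog.
rewrite koszul_d_tr //.
apply/eqP; rewrite -subr_eq0 opprD addrA.
rewrite -(koszul_tr_comp _ _ u0u (leqW uv)) fE -(koszul_tr_comp _ _ uv (leqnSn v)).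
rewrite -(koszul_tr_comp _ _ v_gt0 (leqnSn v)) -!linearB /=; apply/eqP.
apply: (koszul_tr_torsion _ ps).
  by rewrite !rpredB ?koszul_tr_homog //; apply: (koszul_d_homog _ kH).
move=> J; apply: xtor.
suff /ffunP/(_ J) : x i *: (tr u v f - tr 1 v c - d v k) = 0 by rewrite !ffunE.
have dkE : x i *: d v k = d v (tr u v e) - d v (tr 1 v g).
  by rewrite -linearZ /= -kE !linearB /= koszul_dd subr0.
by rewrite !scalerBr dkE !koszul_d_tr // cE -eE !linearZ subrr.
Qed.

End Lifts.

(** Two classes agree in the limit exactly when their representatives differ by a boundary at a
    later stage. Index [u] of the system stands for the exponent [u + 1], which matches the positive
    exponents of [koszul_lifts]. *)
Lemma lambda_surjP (R : comPzRingType) (M : lmodType R) s (x : 'I_s -> R) i :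
  (forall y : local_cohomology M x i,
     exists h : koszul_cohomology M x i, lambda M x i h = y) <->
  koszul_lifts x M (s - i).
Proof.
pose in_lim u (z : koszul_cycles M (powers x u.+1) (s - i)) : local_cohomology M x i :=
  @dirlim_in R (koszul_system M x i) u (quotmod_pi _ z).
have eq_lim u v (z : koszul_cycles M (powers x u.+1) (s - i))
    (y : koszul_cycles M (powers x v.+1) (s - i)) : in_lim u z = in_lim v y <->
    exists w (h : koszul M s), [/\ (u <= w)%N, (v <= w)%N, h \in koszul_homog (s - i).+1
      & koszul_tr x u.+1 w.+1 (val z) =
        koszul_tr x v.+1 w.+1 (val y) + koszul_d (powers x w.+1) h].
  rewrite /in_lim; split=> [/dirlim_in_eq[w [uw [vw]]]|[w [h [uw vw hH zy]]]].
    rewrite /= /homology_tr /= !quotmod_mapE => /quotmod_piP.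
    rewrite koszul_boundariesE => /koszul_boundaryP[h hH zy].
    by exists w, h; split=> //; rewrite -zy addrC subrK.
  apply/dirlim_in_eq; exists w, uw, vw.
  rewrite /= /homology_tr /= !quotmod_mapE; apply/quotmod_piP.
  rewrite koszul_boundariesE; apply/koszul_boundaryP; exists h => //.
  by rewrite /= zy addrAC subrr add0r.
split=> [surj u f u0 fZ|lifts y].
  case: u u0 fZ => // u _ fZ.
  have [h] := surj (in_lim u (KoszulCycle fZ)).
  rewrite -[h]quotmod_reprK; move: (quotmod_repr h) => g /esym/(eq_lim u 0%N)[w [k [uw _ kH e]]].
  by exists w.+1, (val g), k; split=> //; apply: (valP g).
have [u [z <-]] := dirlim_in_surj y.
rewrite -[z]quotmod_reprK; move: (quotmod_repr z) => c.
have [v [g [h [uv gZ hH e]]]] := lifts u.+1 (val c) isT (valP c).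
case: v uv e => // w uw e.
exists (quotmod_pi _ (KoszulCycle gZ)); apply/esym/(eq_lim u 0%N).
by exists w, h.
Qed.

(** * Weak sequences and lifting *)

Section Top.
Variables (R : comPzRingType) (s : nat) (x : 'I_s -> R) (M : lmodType R).

Lemma koszul_homog_gt_top (f : koszul M s) : f \in koszul_homog s.+1 -> f = 0.
Proof.
move=> /koszul_homogP hf; apply/ffunP => J; rewrite ffunE hf //.
by rewrite neq_ltn ltnS -[X in (_ <= X)%N]card_ord max_card.
Qed.

Lemma koszul_homog_top (f : koszul M s) (J : {set 'I_s}) : f \in koszul_homog s ->
  J != finset.setT -> f J = 0.
Proof.
move=> /koszul_homogP hf JT; apply: hf; apply: contraNneq JT => cJ.
by rewrite eqEcard finset.subsetT cardsT card_ord cJ leqnn.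
Qed.

(** There are no chains above the top degree, so the homotopy formula shows that each [y i] kills a
    top cycle. This is the identification of [H^0] with the elements of [M] killed by all [y i]. *)
Lemma koszul_cycle_topP (f : koszul M s) y :
  f \in koszul_cycle y s <-> f \in koszul_homog s /\ forall i, y i *: f = 0.
Proof.
split=> [fZ|[fH yf]].
  have := fZ; rewrite koszul_cycleE => /andP[fH _]; split=> // i.
  rewrite (koszul_wedge_d _ fZ) (@koszul_homog_gt_top (koszul_wedge i f)) ?linear0 //.
  exact: koszul_wedge_homog.
rewrite koszul_cycleE fH; apply/eqP/ffunP => I; rewrite !ffunE big1 // => j jI.
by rewrite -scalerA; have /ffunP/(_ (j |: I)) := yf j; rewrite !ffunE => ->; rewrite scaler0.
Qed.

Lemma koszul_tr_top u v (f : koszul M s) : f \in koszul_homog s -> koszul_tr x u v f = f.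
Proof.
move=> fH; apply/ffunP => J; rewrite ffunE.
have [->|JT] := eqVneq J finset.setT; last by rewrite koszul_homog_top ?scaler0.
by rewrite big1 ?scale1r // => j; rewrite inE.
Qed.

(** In degree 0 the map [lambda] is an inclusion: no boundaries occur and the transition maps are
    identities. Surjectivity then says that torsion elements are killed by [a]. *)
Lemma koszul_lifts_top_torsion u (m : M) : koszul_lifts x M s ->
  (forall j, x j ^+ u *: m = 0) -> forall j, x j *: m = 0.
Proof.
move=> lifts xm j.
pose f : koszul M s := [ffun J => if J == finset.setT then m else 0].
have fH : f \in koszul_homog s.
  apply/koszul_homogP => J; rewrite ffunE.
  by have [->|//] := eqVneq J finset.setT; rewrite cardsT card_ord eqxx.
(* The exponent is raised by one because lifting needs a positive exponent, while [u] may be 0. *)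
have fZ : f \in koszul_cycle (powers x u.+1) s.
  apply/koszul_cycle_topP; split=> // i; apply/ffunP => J; rewrite !ffunE.
  by case: eqP; rewrite ?scaler0 // /powers exprS -scalerA xm scaler0.
have [v [g [h [_ /koszul_cycle_topP[gH xg] hH]]]] := lifts _ _ (ltn0Sn _) fZ.
rewrite (koszul_homog_gt_top hH) linear0 addr0 !koszul_tr_top // => fg.
have := xg j; rewrite -fg => /ffunP/(_ finset.setT); rewrite !ffunE eqxx.
by rewrite /powers expr1.
Qed.

End Top.

(** Both projections are kept: [rho] for the chase between [Q] and [Q'], and [pi'] for reading [Q']
    as a quotient of [M]. *)
Lemma quotient_step (R : comPzRingType) (M Q : lmodType R) (pi : {linear M -> Q})
    s (y : 'I_s -> R) (J : {set 'I_s}) i : i \notin J ->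
  (forall q, exists m, pi m = q) -> (forall m, pi m = 0 <-> gensub M y J m) ->
  exists (Q' : lmodType R) (rho : {linear Q -> Q'}) (pi' : {linear M -> Q'}),
    [/\ forall q, exists m, rho m = q, forall m, rho m = 0 <-> exists v, m = y i *: v,
        forall q, exists m, pi' m = q & forall m, pi' m = 0 <-> gensub M y (i |: J) m].
Proof.
move=> iJ pisurj piker.
have [|Q' [rho [rhosurj rhoker]]] := @quotient_exists R Q [set q | exists v, q = y i *: v].
  apply/submoduleP; split=> [|r _ _ [u ->] [v ->]]; first by exists 0; rewrite scaler0.
  by exists (r *: u + v); rewrite scalerDr !scalerA mulrC.
exists Q', rho, (rho \o pi); split=> // [q|m].
  by have [q' <-] := rhosurj q; have [m <-] := pisurj q'; exists m.
apply: (iff_trans (rhoker _)); split=> [[q pim]|/(gensubU1 _ _ iJ)[u Ju [v ->]]].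
  have [v vq] := pisurj q; apply/gensubU1 => //; exists (m - y i *: v); last first.
    by exists v; rewrite subrK.
  by apply/piker; rewrite linearB linearZ /= pim vq subrr.
by exists (pi v); rewrite linearD linearZ /=; have /piker-> := Ju; rewrite add0r.
Qed.

Section WeakSubsets.
Variables (R : comPzRingType) (s : nat) (x : 'I_s -> R) (M : lmodType R) (n : nat).

(** The order-free form of the weak condition on any [n] elements: a prefix becomes a subset of
    fewer than [n] indices. *)
Definition weak_subsets := forall (alpha : 'I_s -> nat) (J : {set 'I_s}) i (m : M),
  (forall j, 0 < alpha j)%N -> (#|J| < n)%N -> i \notin J ->
  gensub M (fun j => x j ^+ alpha j) J (x i ^+ alpha i *: m) ->
  forall j, gensub M (fun j => x j ^+ alpha j) J (x j *: m).

Hypotheses (weakx : weak_subsets) (ns : (n <= s)%N).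

Lemma exists_notin (J : {set 'I_s}) : (#|J| < n)%N -> exists i, i \notin J.
Proof.
move=> Jn; have [i iJ|J_] := pickP [pred i | i \notin J]; first by exists i.
suff JT : J = finset.setT by move: (leq_trans Jn ns); rewrite JT cardsT card_ord ltnn.
by apply/finset.setP => i; rewrite inE; have := J_ i => /= /negbFE.
Qed.

Lemma gensub_set_exp (V : lmodType R) (alpha : 'I_s -> nat) (J : {set 'I_s}) i u : i \notin J ->
  gensub V (fun j => x j ^+ alpha j) J =
  gensub V (fun j => x j ^+ (if j == i then u else alpha j)) J.
Proof. by move=> iJ; apply: gensub_eq => j jJ; case: eqP iJ => // <-; rewrite jJ. Qed.

(** As [i] is outside [J], its exponent may be changed without affecting the submodule generated by
    [J]; exponent 0 is immediate. *)
Lemma weak_exp alpha (J : {set 'I_s}) i u (m : M) :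
  (forall j, 0 < alpha j)%N -> (#|J| < n)%N -> i \notin J ->
  gensub M (fun j => x j ^+ alpha j) J (x i ^+ u *: m) ->
  forall j, gensub M (fun j => x j ^+ alpha j) J (x j *: m).
Proof.
move=> alpha0 Jn iJ; case: u => [|u] xm j.
  by apply: submodZ; [exact: gensub_submodule|rewrite -[m]scale1r].
rewrite (gensub_set_exp _ _ u.+1 iJ) in xm *.
apply: (@weakx _ J i) => // [k|]; first by case: eqP.
by rewrite eqxx.
Qed.

(* The d-sequence property: the socle of M/x_J M avoids x_L M. *)
Lemma weak_inter (J L : {set 'I_s}) (m : M) : J \subset L -> (#|L| <= n)%N ->
  gensub M x L m -> (forall j, gensub M x J (x j *: m)) -> gensub M x J m.
Proof.
move=> JL Ln Lm xm; move Ek : #|L| => k.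
elim: k L JL Ln Lm Ek => [|k IH] L JL Ln Lm Ek.
  by move: JL; have /eqP := Ek; rewrite cards_eq0 => /eqP L0; rewrite L0 in Lm *;
    rewrite finset.subset0 => /eqP->.
have [LJ|] := boolP (L \subset J); first exact: gensubS Lm.
case/subsetPn => i iL iJ; pose L' := (L :\ i)%SET.
have iL' : i \notin L' by rewrite !inE eqxx.
have LE : L = i |: L' by rewrite finset.setD1K.
have cL : #|L'| = k by move: Ek; rewrite LE cardsU1 iL' => -[].
have JL' : J \subset L' by rewrite subsetD1 JL.
have subL' := gensub_submodule M x L'.
apply: (IH L') => //; first by rewrite cL -ltnS -Ek ltnW.
move: Lm; rewrite LE => /(gensubU1 _ _ iL')[u L'u [v mE]].
rewrite mE; apply: submodD => //.
have e1 : gensub M x L' = gensub M (fun j => x j ^+ 1) L' by apply: gensub_eq.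
(* With [m = u + x_i v], the hypothesis only places [x_i^2 v] in [x_L' M]; weakness for the square
   [x_i^2] brings this down to [x_i v]. *)
rewrite e1; apply: (@weak_exp (fun=> 1%N) _ i 2) => //; first by rewrite cL -Ek.
rewrite -e1 expr2 -scalerA.
have -> : x i *: v = m - u by rewrite mE addrC addKr.
by rewrite scalerBr; apply: submodB => //; [apply: gensubS (xm i)|apply: submodZ].
Qed.

Section Quotient.
Variables (alpha : 'I_s -> nat) (J : {set 'I_s}) (Q : lmodType R) (pi : {linear M -> Q}).
Hypothesis alpha0 : (forall j, 0 < alpha j)%N.
Hypothesis pisurj : forall q, exists m, pi m = q.
Hypothesis piker : forall m, pi m = 0 <-> gensub M (fun j => x j ^+ alpha j) J m.
Hypothesis Jn : (#|J| < n)%N.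

Lemma weak_quotient_torsion i u (q : Q) : i \notin J -> x i ^+ u *: q = 0 ->
  forall j, x j *: q = 0.
Proof.
move=> iJ; have [m <-] := pisurj q; rewrite -linearZ => /piker xm j.
by rewrite -linearZ; apply/piker; apply: weak_exp xm j.
Qed.

Lemma weak_quotient_cycle_top u (f : koszul Q s) j :
  f \in koszul_cycle (powers x u) s -> x j *: f = 0.
Proof.
move=> /koszul_cycle_topP[_ xf]; have [i iJ] := exists_notin Jn.
apply/ffunP => I; rewrite !ffunE; apply: (weak_quotient_torsion (u := u) iJ).
by have /ffunP/(_ I) := xf i; rewrite !ffunE.
Qed.

End Quotient.

(** Each step divides by a power of some [x_i] outside [J] and lowers the cohomological degree by
    one. At degree 0 a cycle is killed by a power of such an [x_i], hence by [a]. The exponents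
    [alpha] vary because the step must allow every power. *)
Lemma weak_killed k alpha (J : {set 'I_s}) (Q : lmodType R) (pi : {linear M -> Q}) :
  (forall j, 0 < alpha j)%N -> (forall q, exists m, pi m = q) ->
  (forall m, pi m = 0 <-> gensub M (fun j => x j ^+ alpha j) J m) ->
  (#|J| + k < n)%N -> koszul_killed x Q (s - k).
Proof.
elim: k alpha J Q pi => [|k IH] alpha J Q pi alpha0 pisurj piker Jkn.
  rewrite subn0 => u f j u0 fZ; exists u, 0; split; rewrite ?rpred0 //.
  rewrite linear0 koszul_trxx.
  by rewrite (weak_quotient_cycle_top alpha0 pisurj piker _ _ fZ) // -[#|J|]addn0.
have Jn : (#|J| < n)%N by apply: leq_ltn_trans Jkn; apply: leq_addr.
have [i iJ] := exists_notin Jn.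
have ks : (k < s)%N by lia.
apply: (@koszul_killed_quotient _ _ _ _ i) => [u m||]; last by lia.
  exact: (weak_quotient_torsion alpha0 pisurj piker Jn iJ).
move=> u u0; pose beta j := if j == i then u else alpha j.
have piker' m : pi m = 0 <-> gensub M (fun j => x j ^+ beta j) J m.
  by rewrite /beta -gensub_set_exp.
have [Q' [rho [pi' [rhosurj rhoker pisurj' pi'ker]]]] := quotient_step iJ pisurj piker'.
exists Q', rho; split=> //; first by move: rhoker; rewrite /beta eqxx.
rewrite -subSn // subSS; apply: (IH beta _ _ pi') => //.
  by move=> j; rewrite /beta; case: eqP.
by rewrite cardsU1 iJ; lia.
Qed.

(** Induction on the cohomological degree [k] through [koszul_lifts_step]. For [k = 0] a cycle at
    any stage is killed by [a], so it is already a cycle for [x] itself. *)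
Lemma weak_lifts_quotient k (J : {set 'I_s}) (Q : lmodType R) (pi : {linear M -> Q}) :
  (forall q, exists m, pi m = q) -> (forall m, pi m = 0 <-> gensub M x J m) ->
  (#|J| + k < n)%N -> koszul_lifts x Q (s - k).
Proof.
elim: k J Q pi => [|k IH] J Q pi pisurj piker Jkn.
all: have piker1 m : pi m = 0 <-> gensub M (fun j => x j ^+ 1) J m by [].
all: have Jn : (#|J| < n)%N by apply: leq_ltn_trans Jkn; apply: leq_addr.
  rewrite subn0 => u f u0 fZ.
  have xf j := weak_quotient_cycle_top (alpha := fun=> 1%N) (fun=> isT) pisurj piker1 Jn j fZ.
  have /koszul_cycle_topP[fH _] := fZ.
  exists u, f, 0; split; rewrite ?rpred0 ?linear0 ?addr0 ?koszul_tr_top //.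
  by apply/koszul_cycle_topP; split=> // j; rewrite /powers expr1.
have [i iJ] := exists_notin Jn.
have ks : (k < s)%N by lia.
have [Q' [rho [pi' [rhosurj rhoker pisurj' pi'ker]]]] := quotient_step iJ pisurj piker.
apply: (@koszul_lifts_step _ _ _ _ _ rho i) => //.
- move=> q xq; apply: (weak_quotient_torsion (alpha := fun=> 1%N) (fun=> isT) pisurj piker1 Jn iJ (u := 1)).
  by rewrite expr1.
- move=> I _ Icard [h ->] xq.
  have /choice[h' h'E] j := pisurj (h j).
  pose m := \sum_(j in (~: I)%SET) x j *: h' j.
  have mE : pi m = \sum_(j in (~: I)%SET) x j *: h j.
    by rewrite linear_sum; apply: eq_bigr => j _; rewrite linearZ h'E.
  (* Here [#|I| = s - k - 2], so the union of [J] and the complement of [I] has at most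
     [#|J| + k + 2 <= n] elements. *)
  rewrite -mE in xq *; apply/piker; apply: (@weak_inter J (J :|: ~: I)%SET).
  + exact: finset.subsetUl.
  + have := (leq_card_setU J (~: I)%SET).1; have := cardsC I; rewrite card_ord; lia.
  + by apply: gensubS (finset.subsetUr _ _) _ _; exists h'.
  + by move=> j; apply/piker; rewrite linearZ; apply: xq.
- lia.
- exact: (weak_killed (alpha := fun=> 1%N) (fun=> isT) pisurj piker1).
- rewrite -subSn // subSS; apply: (IH _ _ pi') => //.
  by rewrite cardsU1 iJ; lia.
Qed.

Lemma weak_lifts k : (k < n)%N -> koszul_lifts x M (s - k).
Proof.
move=> kn; apply: (@weak_lifts_quotient k finset.set0 M idfun) => [q|m|].
- by exists q.
- by rewrite gensub0.
- by rewrite cards0.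
Qed.

End WeakSubsets.

(** * From lifting to weakness, for filter regular families in the ideal *)

Section LiftsWeak.
Variables (R : comPzRingType) (s : nat) (x : 'I_s -> R) (M : lmodType R) (n r : nat).
Variable z : 'I_r -> R.
Hypothesis za : forall k, ideal_gen (range x) (z k).
Hypothesis zreg : forall (J : {set 'I_r}) i, i \notin J -> filter_nzd x (gensub M z J) (z i).

(** Filter regularity makes an element killed by [z_i] torsion; lifting in degree 0 then makes [a]
    kill it. *)
Lemma lifts_quotient_torsion (J : {set 'I_r}) i (Q : lmodType R) (pi : {linear M -> Q}) (q : Q) :
  i \notin J -> (forall q, exists m, pi m = q) ->
  (forall m, pi m = 0 <-> gensub M z J m) -> koszul_lifts x Q s ->
  z i *: q = 0 -> forall j, x j *: q = 0.
Proof.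
move=> iJ pisurj piker lifts; have [m <-] := pisurj q.
rewrite -linearZ => /piker /(zreg iJ)[t _ tm].
apply: (koszul_lifts_top_torsion (u := t) lifts) => j.
by rewrite -linearZ; apply/piker; apply: tm; apply: exp_idealX; apply: gen_in.
Qed.

Hypothesis ns : (n <= s)%N.
Hypothesis lifts : forall k, (k < n)%N -> koszul_lifts x M (s - k).

(** Dividing by one more [z_i] costs one cohomological degree: lifting in degree [l] for the new
    quotient uses degrees [l] and [l + 1] for the old one. *)
Lemma lifts_quotient (J : {set 'I_r}) : (#|J| < n)%N ->
  exists (Q : lmodType R) (pi : {linear M -> Q}),
    [/\ forall q, exists m, pi m = q, forall m, pi m = 0 <-> gensub M z J m
      & forall k, (#|J| + k < n)%N -> koszul_lifts x Q (s - k)].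
Proof.
move Ek : #|J| => k; elim: k J Ek => [|k IH] J Ek kn.
  exists M, idfun; split=> // [q|m]; first by exists q.
  by have /eqP := Ek; rewrite cards_eq0 => /eqP->; rewrite gensub0.
have [i iJ] : exists i, i \in J by apply/card_gt0P; rewrite Ek.
pose J' := (J :\ i)%SET; have iJ' : i \notin J' by rewrite !inE eqxx.
have JE : J = i |: J' by rewrite finset.setD1K.
have cJ' : #|J'| = k by move: Ek; rewrite JE cardsU1 iJ' => -[].
have [Q [pi [pisurj piker liftQ]]] := IH _ cJ' (ltnW kn).
have [Q' [rho [pi' [rhosurj rhoker pisurj' pi'ker]]]] := quotient_step iJ' pisurj piker.
rewrite -JE in pi'ker; exists Q', pi'; split=> // l kln.
have [c zE] : exists c : 'I_s -> R, z i = \sum_j c j * x j.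
  by apply/ideal_gen_rangeP; apply: za.
have -> : (s - l = (s - l.+1).+1)%N by lia.
apply: (koszul_lifts_quotient (pi := rho) (c := c) zE) => //.
- move=> q; apply: (lifts_quotient_torsion iJ' pisurj piker).
  by have := liftQ 0%N; rewrite subn0; apply; lia.
- lia.
- have -> : ((s - l.+1).+1 = s - l)%N by lia.
  by apply: liftQ; lia.
- by apply: liftQ; lia.
Qed.

Lemma lifts_weak (J : {set 'I_r}) i (m : M) : (#|J| < n)%N -> i \notin J ->
  gensub M z J (z i *: m) -> colon (gensub M z J) (ideal_gen (range x)) m.
Proof.
move=> Jn iJ zm; have [Q [pi [pisurj piker liftQ]]] := lifts_quotient Jn.
move=> _ /ideal_gen_rangeP[c ->]; rewrite scaler_suml.
apply: submod_sum => [|j _]; first exact: gensub_submodule.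
rewrite -scalerA; apply: submodZ; first exact: gensub_submodule.
have liftQ0 : koszul_lifts x Q s by have := liftQ 0%N; rewrite subn0; apply; lia.
apply/piker; rewrite linearZ; apply: (lifts_quotient_torsion iJ pisurj piker liftQ0).
by rewrite -linearZ; apply/piker.
Qed.

End LiftsWeak.

(** * Ordered sequences and subsets of the index set *)

Lemma enum_prefix n s (J : {set 'I_s}) (i : 'I_s) :
  (n <= s)%N -> (#|J| < n)%N -> i \notin J ->
  exists (f : 'I_n -> 'I_s) (k : 'I_n),
    [/\ injective f, f k = i & [set f j | j : 'I_n & (j < k)%N]%SET = J].
Proof.
(* The list runs through [J], then [i], then the remaining indices; its first [n] entries define
   [f], and [i] stands at position [#|J|]. *)
move=> ns Jn iJ; pose l := enum J ++ i :: enum (~: (i |: J))%SET.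
have sl : size l = s.
  rewrite size_cat /= -!cardE; have := cardsC (i |: J); rewrite card_ord cardsU1 iJ.
  by rewrite addnS addSn.
have ul : uniq l.
  rewrite cat_uniq /= !enum_uniq !mem_enum !inE eqxx /= andbT negb_or iJ /=.
  by apply/hasPn => j; rewrite !mem_enum !inE negb_or => /andP[].
exists (fun k => nth i l k), (Ordinal Jn); split.
- move=> j k /eqP; rewrite nth_uniq ?sl // => [/eqP/val_inj//||];
    exact: leq_trans (ltn_ord _) ns.
- by rewrite /= nth_cat -cardE ltnn subnn.
- apply/finset.setP => j; apply/imsetP/idP => [[k]|jJ].
    rewrite inE /= => kJ ->; rewrite nth_cat -cardE kJ -mem_enum mem_nth //.
    by rewrite -cardE.
  have jl : (index j (enum J) < #|J|)%N by rewrite cardE index_mem mem_enum.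
  exists (Ordinal (ltn_trans jl Jn)); first by rewrite inE.
  by rewrite /= nth_cat -cardE jl nth_index // mem_enum.
Qed.

Lemma notin_prefix r s (f : 'I_r -> 'I_s) (i : 'I_r) :
  injective f -> f i \notin [set f j | j : 'I_r & (j < i)%N]%SET.
Proof. by move=> injf; rewrite mem_imset // inE ltnn. Qed.

Section Sequences.
Variables (R : comPzRingType) (s : nat) (x : 'I_s -> R) (M : lmodType R).
Local Notation a := (ideal_gen (range x)).

Lemma weak_subsetsP n : (n <= s)%N ->
  (forall f : 'I_n -> 'I_s, injective f -> uncond_weak_sequence a M (fun k => x (f k))) ->
  weak_subsets x M n.
Proof.
move=> ns weakx alpha J i m alpha0 Jn iJ.
have [f [k [injf <- <-]]] := enum_prefix ns Jn iJ.
(* The order is already encoded in [f], so the identity permutation suffices. *)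
have := weakx f injf (fun j => alpha (f j)) (fun j => alpha0 (f j)) 1%g k m.
rewrite /colon_elt /colon /=.
rewrite (@prefix_gensub _ M _ _ (fun j => x j ^+ alpha j) (fun j => f ((1 : 'S_n)%g j))).
have -> : [set f ((1 : 'S_n)%g j) | j : 'I_n & (j < k)%N]%SET =
          [set f j | j : 'I_n & (j < k)%N]%SET.
  by apply: eq_imset => j; rewrite perm1.
by rewrite perm1 => weakm /weakm am j; apply: am; apply: gen_in.
Qed.

Definition subset_regular r (z : 'I_r -> R) :=
  forall (J : {set 'I_r}) i, i \notin J -> filter_nzd x (gensub M z J) (z i).

Lemma subset_regularP r (z : 'I_r -> R) :
  uncond_filter_regular a M z <-> subset_regular z.
Proof.
split=> [zreg J i iJ m zm|zreg g i m].
  have Jr : (#|J| < r)%N.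
    rewrite -[X in (_ < X)%N]card_ord -cardsT; apply: proper_card.
    by rewrite properT; apply: contraNneq iJ => ->; rewrite inE.
  have [f [k [injf fk fJ]]] := enum_prefix (leqnn r) Jr iJ.
  have := zreg (perm injf) k m.
  rewrite (@prefix_gensub _ M _ _ z (perm injf)) /colon_elt /= permE fk.
  have -> : [set perm injf j | j : 'I_r & (j < k)%N]%SET = J.
    by rewrite -fJ; apply: eq_imset => j; rewrite permE.
  exact.
by rewrite prefix_gensub; apply: zreg; apply/notin_prefix/perm_inj.
Qed.

Lemma subset_regular_sub r t (z : 'I_r -> R) (f : 'I_t -> 'I_r) :
  injective f -> subset_regular z -> subset_regular (fun k => z (f k)).
Proof.
by move=> injf zreg J i iJ; rewrite gensub_imset //; apply: zreg; rewrite mem_imset.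
Qed.

Lemma gensub_add_multiples r (z : 'I_r -> R) (J : {set 'I_r}) i : i \notin J ->
  gensub M z (i |: J) = add_multiples (gensub M z J) (z i).
Proof. by move=> iJ; apply/seteqP; split=> m /(gensubU1 _ _ iJ). Qed.

(** Raising one element to a power affects either the tested element, settled by [filter_nzd_exp],
    or the submodule, settled by [filter_nzd_add_exp]. *)
Lemma subset_regular_exp1 r (z : 'I_r -> R) k e : subset_regular z ->
  subset_regular (fun j => if j == k then z j ^+ e else z j).
Proof.
move=> zreg J i iJ; set w := fun j => _.
have wJ (L : {set 'I_r}) : k \notin L -> gensub M w L = gensub M z L.
  by move=> kL; apply: gensub_eq => j jL; rewrite /w; case: eqP jL kL => // -> ->.
have [kJ|kJ] := boolP (k \in J); last first.
  rewrite wJ // /w; case: eqP => _; last exact: zreg.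
  by apply: filter_nzd_exp; [exact: gensub_submodule|exact: zreg].
have ik : i != k by apply: contraNneq iJ => ->.
pose J' := (J :\ k)%SET; have kJ' : k \notin J' by rewrite !inE eqxx.
have JE : J = k |: J' by rewrite finset.setD1K.
rewrite JE gensub_add_multiples // wJ // /w eqxx (negPf ik).
apply: filter_nzd_add_exp; first exact: gensub_submodule.
  exact: zreg.
by rewrite -gensub_add_multiples // -JE; apply: zreg.
Qed.

Lemma subset_regular_exp r (z : 'I_r -> R) alpha : subset_regular z ->
  subset_regular (fun j => z j ^+ alpha j).
Proof.
move=> zreg; have : uniq (enum 'I_r) by apply: enum_uniq.
have -> : (fun j => z j ^+ alpha j) =
          (fun j => if j \in enum 'I_r then z j ^+ alpha j else z j).
  by apply/funext => j; rewrite mem_enum.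
elim: (enum 'I_r) => //= k l IH /andP[kl /IH zl].
have := subset_regular_exp1 (k := k) (e := alpha k) zl.
congr (subset_regular _); apply/funext => j; rewrite inE.
by case: eqVneq => [->|]; rewrite ?(negPf kl).
Qed.

(** The lifting property concerns [x], but weakness is obtained for any [z] generating the same
    ideal: powers with positive exponent stay in [a] and remain filter regular. *)
Lemma lifts_uncond_weak r n (z : 'I_r -> R) (f : 'I_n -> 'I_r) :
  ideal_gen (range z) = a -> uncond_filter_regular a M z -> injective f -> (n <= s)%N ->
  (forall k, (k < n)%N -> koszul_lifts x M (s - k)) ->
  uncond_weak_sequence a M (fun k => z (f k)).
Proof.
move=> za /subset_regularP/(subset_regular_sub (f := f)) zreg injf ns lifts alpha alpha0 g i.
have {}zreg := subset_regular_exp (alpha := alpha) (zreg injf).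
rewrite (@prefix_gensub _ M _ _ (fun k => z (f k) ^+ alpha k) g) => m.
apply: (lifts_weak _ zreg ns lifts) => [k||].
- have azk : a (z (f k)) by rewrite -za; apply: gen_in.
  have := alpha0 k; case: (alpha k) => // e _; rewrite exprSr.
  exact: (submodZ (@span_submodule R R^o _) (z (f k) ^+ e) azk).
- apply: leq_ltn_trans (ltn_ord i); apply: leq_trans (leq_imset_card _ _) _.
  rewrite -[X in (_ <= X)%N](size_iota 0) cardE -(size_map val).
  apply: uniq_leq_size; first by rewrite map_inj_uniq ?enum_uniq //; apply: val_inj.
  by move=> _ /mapP[j + ->]; rewrite mem_enum inE mem_iota.
- exact/notin_prefix/perm_inj.
Qed.

End Sequences.

(** * Prime avoidance and existence of f-generating sets *)

Section Noetherian.
Variable R : comPzRingType.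

(** Arbitrary finite index types let two generating families be joined over a sum type. *)
Definition noetherian_module (V : lmodType R) := forall N : set V, submodule N ->
  exists (T : finType) (y : T -> V), span (range y) = N.

Lemma span_range_add (V : lmodType R) (T1 T2 : finType) (y1 : T1 -> V) (y2 : T2 -> V)
    (N : set V) : submodule N ->
  (forall t, N (y1 t)) -> (forall t, N (y2 t)) ->
  (forall v, N v -> exists2 u, span (range y1) u & span (range y2) (v - u)) ->
  exists (T : finType) (y : T -> V), span (range y) = N.
Proof.
move=> subN N1 N2 dec; exists (T1 + T2)%type.
exists (fun t => match t with inl t => y1 t | inr t => y2 t end).
apply/seteqP; split=> [|v /dec[u u1 u2]].
  by apply: span_min => // _ [[t|t] _ <-].
rewrite -[v](subrK u); apply: (submodD (@span_submodule _ _ _)).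
  move: u2; apply: span_min; first exact: span_submodule.
  by move=> _ [t _ <-]; apply: sub_span; exists (inr t).
move: u1; apply: span_min; first exact: span_submodule.
by move=> _ [t _ <-]; apply: sub_span; exists (inl t).
Qed.

(** Induction on the number of generators: lift generators of the ideal [I] of first coefficients of
    elements of [N], and add generators of the part of [N] in the span of the other generators. *)
Lemma noetherian_fingen (V : lmodType R) : noetherian R -> fingen V -> noetherian_module V.
Proof.
move=> noethR [s [m mV]] N subN.
have : N `<=` span (range m) by rewrite mV.
elim: s m {mV} N subN => [|s IH] m N subN Nm.
  exists void, (fun t : void => match t with end); apply/seteqP; split=> [|v /Nm].
    by apply: span_min => // _ [[]].
  by move=> /span_rangeP[c ->]; rewrite big_ord0; apply: (submod0 (@span_submodule _ _ _)).
pose m' j := m (lift ord0 j).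
pose I : set R := [set r | exists2 w, span (range m') w & N (r *: m ord0 + w)].
have [|k [r rI]] := noethR I.
  apply/(submoduleP (I : set R^o)); split=> [|t u v [w uw Nw] [w' vw' Nw']].
    exists 0; first apply: (submod0 (@span_submodule _ _ _)).
    by rewrite scale0r addr0; apply: submod0.
  exists (t *: w + w').
    by apply: (submodD (@span_submodule _ _ _)) => //; apply: (submodZ (@span_submodule _ _ _)).
  rewrite [t *: u]/(t * u) scalerDl -scalerA addrACA -scalerDr.
  by apply: submodD => //; apply: submodZ.
have /choice[w /all_and2[wm wN]] j :
    exists w, span (range m') w /\ N (r j *: m ord0 + w).
  have [w mw Nw] : I (r j) by rewrite -rI; apply: gen_in.
  by exists w.
have subN' : submodule (N `&` span (range m')).
  apply/submoduleP; split=> [|t u v [Nu mu] [Nv mv]].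
    by split; [exact: submod0|apply: (submod0 (@span_submodule _ _ _))].
  split; first by apply: submodD => //; apply: submodZ.
  by apply: (submodD (@span_submodule _ _ _)) => //; apply: (submodZ (@span_submodule _ _ _)).
have [T [y yN']] := IH m' _ subN' (fun v => @proj2 _ _).
apply: (@span_range_add _ 'I_k T (fun j => r j *: m ord0 + w j) y) => // [t|v Nv].
  by have [] : (N `&` span (range m')) (y t) by rewrite -yN'; apply: sub_span; exists t.
have [c vE] := (span_rangeP _ _).1 (Nm _ Nv).
move: vE; rewrite big_ord_recl => vE.
have tail : span (range m') (v - c ord0 *: m ord0).
  by rewrite vE addrC addKr; apply/span_rangeP; exists (fun j => c (lift ord0 j)).
have : I (c ord0).
  exists (v - c ord0 *: m ord0) => //; by rewrite addrC subrK.
rewrite -rI => /ideal_gen_rangeP[b cE].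
exists (\sum_j b j *: (r j *: m ord0 + w j)); first by apply/span_rangeP; exists b.
rewrite yN'; split.
  by apply: submodB => //; apply: submod_sum => // j _; apply: submodZ.
have -> : \sum_j b j *: (r j *: m ord0 + w j) = c ord0 *: m ord0 + \sum_j b j *: w j.
  rewrite cE scaler_suml -big_split; apply: eq_bigr => j _.
  by rewrite scalerDr scalerA.
rewrite opprD addrA; apply: (submodB (@span_submodule _ _ _)) => //.
apply: (submod_sum (@span_submodule _ _ _)) => j _.
by apply: (submodZ (@span_submodule _ _ _)).
Qed.

Lemma noetherian_maximal (V : lmodType R) (F : set (set V)) : noetherian_module V ->
  (forall N, F N -> submodule N) -> F !=set0 ->
  exists2 N, F N & forall N', F N' -> N `<=` N' -> N' `<=` N.
Proof.
move=> noethV subF [N0 FN0]; apply: contrapT => nomax.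
have /choice[next nextP] (N : {N | F N}) : exists N' : {N | F N},
    sval N `<=` sval N' /\ ~ sval N' `<=` sval N.
  case: N => N FN /=; apply: contrapT => maxN; apply: nomax; exists N => // N' FN' NN'.
  by apply: contrapT => N'N; apply: maxN; exists (exist _ N' FN').
pose C k := sval (iter k next (exist _ N0 FN0)).
have subC k : submodule (C k) by apply: subF; apply: svalP.
have CS k : C k `<=` C k.+1 by have [] := nextP (iter k next (exist _ N0 FN0)).
have Cmono k l : (k <= l)%N -> C k `<=` C l.
  by move=> /subnK<-; elim: (l - k)%N => // i IH; apply: subset_trans IH (CS _).
have [|T [y yC]] := noethV (\bigcup_k C k).
  apply/submoduleP; split=> [|r u v [k _ ku] [l _ lv]]; first by exists 0%N => //; apply: submod0.
  exists (maxn k l) => //; apply: submodD => //.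
    by apply: submodZ => //; apply: Cmono ku; apply: leq_maxl.
  by apply: Cmono lv; apply: leq_maxr.
have /choice[k kP] t : exists k, C k (y t).
  have [k _ ky] : (\bigcup_k C k) (y t) by rewrite -yC; apply: sub_span; exists t.
  by exists k.
pose K := \max_t k t.
have CK : \bigcup_k C k `<=` C K.
  rewrite -yC; apply: span_min => // _ [t _ <-].
  by apply: Cmono (kP t); apply: leq_bigmax.
have [_] := nextP (iter K next (exist _ N0 FN0)); apply=> v Cv.
by apply: CK; exists K.+1.
Qed.

Definition prime_ideal (P : set R) :=
  [/\ ideal P, ~ P 1 & forall r t, P (r * t) -> P r \/ P t].

Lemma prime_ideal_prod (P : set R) (I : Type) (l : seq I) (Q : pred I) (F : I -> R) :
  prime_ideal P -> (forall i, Q i -> ~ P (F i)) -> ~ P (\prod_(i <- l | Q i) F i).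
Proof.
move=> [_ P1 PM] PF; elim/big_rec: _ => // i r Qi Pr /PM[|//]; exact: PF.
Qed.

Lemma idealMl (P : set R) r t : ideal P -> P t -> P (r * t).
Proof. by move=> idP Pt; apply: (submodZ idP). Qed.

Lemma idealMr (P : set R) r t : ideal P -> P r -> P (r * t).
Proof. by move=> idP Pt; rewrite mulrC; apply: idealMl. Qed.

Lemma ideal_prod (P : set R) (T : finType) (Q : pred T) (F : T -> R) t :
  ideal P -> Q t -> P (F t) -> P (\prod_(i | Q i) F i).
Proof. by move=> idP Qt Pt; rewrite (bigD1 t) //=; apply: idealMr. Qed.

(* Davis' form of prime avoidance, for a coset instead of an ideal. *)
Lemma coset_prime_avoidance (T : finType) (P : T -> set R) (a I : set R) y :
  (forall t, prime_ideal (P t)) -> (forall t, ~ a `<=` P t) -> ideal I ->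
  (forall b, a b -> exists r, I (b - r * y)) ->
  exists2 c, I c & forall t, ~ P t (y + c).
Proof.
move=> primeP aP idI aE.
suff av (A : {set T}) : exists2 c, I c & forall t, t \in A -> ~ P t (y + c).
  by have [c Ic cP] := av finset.setT; exists c => // t; apply: cP; rewrite inE.
move Ek : #|A| => k; elim: k A Ek => [|k IH] A Ek.
  exists 0; first exact: (submod0 idI).
  by move=> t tA; have := card0_eq Ek t; rewrite tA.
have [i iA] : exists i, i \in A by apply/card_gt0P; rewrite Ek.
have cD j : j \in A -> #|(A :\ j)%SET| = k.
  by move=> jA; have := cardsD1 j A; rewrite jA Ek => -[].
have [[j [jA ji Pji]]|incomp] := pselect (exists j, [/\ j \in A, j != i & P j `<=` P i]).
  have [c Ic cP] := IH _ (cD j jA); exists c => // t tA.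
  have [->|tj] := eqVneq t j; last by apply: cP; rewrite !inE tj.
  by move=> /Pji; apply: cP; rewrite !inE eq_sym ji.
have [c Ic cP] := IH _ (cD i iA).
have [idPi _ _] := primeP i.
have [Pic|Pic] := pselect (P i (y + c)); last first.
  exists c => // t tA; have [->//|ti] := eqVneq t i.
  by apply: cP; rewrite !inE ti.
(* If [I] were inside [P i], then [y] would be too, hence also [a], which lies in [I + R y]. *)
have [d0 Id0 Pid0] : exists2 d, I d & ~ P i d.
  apply: contrapT => IP; apply: (aP i) => b /aE[r Ir].
  have {}IP d : I d -> P i d by move=> Id; apply: contrapT => Pd; apply: IP; exists d.
  rewrite -[b](subrK (r * y)); apply: (submodD idPi); first exact: IP.
  by apply: idealMl => //; rewrite -[y](addrK c); apply: (submodB idPi) => //; apply: IP.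
have /choice[q qP] j : exists q, j \in (A :\ i)%SET -> P j q /\ ~ P i q.
  have [jA|_] := boolP (j \in (A :\ i)%SET); last by exists 0.
  apply: contrapT => Pji; apply: incomp; exists j.
  move: jA; rewrite !inE => /andP[ji jA]; split=> // q Pjq.
  by apply: contrapT => Piq; apply: Pji; exists q.
(* The correction [d] lies in [I] and in all the other primes but not in [P i], so adding it repairs
   [P i] and spoils nothing else. *)
pose d := d0 * \prod_(j in (A :\ i)%SET) q j.
have Pid : ~ P i d.
  have [_ _ PiM] := primeP i; move=> /PiM[//|].
  by apply: prime_ideal_prod => // j jA; have [] := qP j jA.
exists (c + d); first by apply: (submodD idI) => //; apply: idealMr.
move=> t tA Pt; have [ti|ti] := eqVneq t i.
  apply: Pid; have -> : d = y + (c + d) - (y + c) by rewrite addrA [_ + d]addrC addrK.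
  by apply: (submodB idPi) => //; rewrite -ti.
have tAi : t \in (A :\ i)%SET by rewrite !inE ti.
have [idPt _ _] := primeP t; apply: (cP t tAi).
have -> : y + c = y + (c + d) - d by rewrite addrA addrK.
apply: (submodB idPt) => //; apply: idealMl => //.
by apply: (ideal_prod (t := t)) => //; have [] := qP t tAi.
Qed.

(** * Finitely many primes that detect filter regularity *)

Section Primes.
Variables (s : nat) (x : 'I_s -> R) (V : lmodType R) (N : set V).
Local Notation a := (ideal_gen (range x)).
Hypotheses (noethR : noetherian R) (fgV : fingen V) (subN : submodule N).

Local Notation G := (torsion x N).
Let ann (v : V) : set R := [set r | G (r *: v)].
(* The maximal annihilators of elements of V / G. *)
Let critical (v : V) := ~ G v /\ forall w, ~ G w -> ann v `<=` ann w -> ann w `<=` ann v.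

Let subG : submodule G. Proof. exact: torsion_submodule. Qed.

Let ann_ideal v : ideal (ann v).
Proof.
apply/(submoduleP (ann v : set R^o)); split=> [|r t u tv uv]; rewrite /ann /=.
  by rewrite scale0r; exact: (submod0 subG).
by rewrite scalerDl -scalerA; apply: (submodD subG) => //; apply: (submodZ subG).
Qed.

Let noeth_ideals : noetherian_module R^o.
Proof. by move=> I idI; have [k [y yI]] := noethR idI; exists 'I_k, y. Qed.

Let critical_above w : ~ G w -> exists2 v, critical v & ann w `<=` ann v.
Proof.
move=> Gw; pose F : set (set R^o) := [set ann v | v in [set v | ~ G v /\ ann w `<=` ann v]].
have [||_ [v [Gv wv] <-] vmax] := @noetherian_maximal R^o F noeth_ideals.
- by move=> _ [v _ <-]; apply: ann_ideal.
- by exists (ann w); exists w => //; split=> // r.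
exists v => //; split=> // u Gu vu; apply: vmax => //; exists u => //.
by split=> //; apply: subset_trans vu.
Qed.

(** If [t v] is not in [G], then [ann v] is contained in [ann (t v)], and maximality gives
    equality. *)
Let critical_prime v : critical v -> prime_ideal (ann v).
Proof.
move=> [Gv vmax]; split=> [||r t rtv]; first exact: ann_ideal.
  by rewrite /ann /= scale1r.
have [tv|tv] := pselect (G (t *: v)); [by right|left].
apply: (vmax _ tv) => [u uv|]; rewrite /ann /= scalerA //.
by rewrite mulrC -scalerA; apply: (submodZ subG).
Qed.

Let critical_not_sub v : critical v -> ~ a `<=` ann v.
Proof.
move=> [Gv _] av; apply: Gv; apply: torsion_gen => // j; apply: av; exact: gen_in.
Qed.

(** Take critical elements [v_i] whose span with [G] is maximal; it contains every critical [w]. If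
    no [ann v_i] were inside [ann w], a product of elements [r_i] of [ann v_i] outside [ann w] would
    send [w] into [G], against primality. *)
Let critical_finite : exists k (v : 'I_k -> V),
  (forall i, critical (v i)) /\ forall w, critical w -> exists i, ann (v i) `<=` ann w.
Proof.
pose S (l : seq V) : set V := span (G `|` [set v | v \in l]).
pose F : set (set V) := [set S l | l in [set l | forall v, v \in l -> critical v]].
have [||_ [l lcrit <-] lmax] := @noetherian_maximal V F (noetherian_fingen noethR fgV).
- by move=> _ [l _ <-]; apply: span_submodule.
- by exists (S [::]); exists [::].
exists (size l), (tnth (in_tuple l)); split=> [i|w wcrit].
  by apply: lcrit; rewrite mem_tnth.
apply: contrapT => nosub.
have /choice[r rP] i : exists r, ann (tnth (in_tuple l) i) r /\ ~ ann w r.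
  apply: contrapT => nor; apply: nosub; exists i => r ri.
  by apply: contrapT => wr; apply: nor; exists r.
have Slw : S l w.
  have : S (w :: l) `<=` S l.
    apply: lmax.
      by exists (w :: l) => // v; rewrite inE => /predU1P[->|/lcrit].
    apply: span_min; first exact: span_submodule.
    move=> v [Gv|lv]; apply: sub_span; [by left|right].
    by rewrite /= inE [_ \in l]lv orbT.
  by apply; apply: sub_span; right; rewrite /= inE eqxx.
apply: (@prime_ideal_prod (ann w) _ (index_enum 'I_(size l)) xpredT r) => [|i _|].
- exact: critical_prime.
- by have [] := rP i.
move: Slw; rewrite /S; apply: (@span_min _ _ _ [set v | G (_ *: v)]).
  apply/submoduleP; split=> [|t u v Gu Gv]; first by rewrite /= scaler0; exact: (submod0 subG).
  rewrite /= scalerDr scalerA mulrC -scalerA.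
  by apply: (submodD subG) => //; apply: (submodZ subG).
move=> v [Gv|lv]; first exact: (submodZ subG).
have [i ->] := tnthP (in_tuple l) v lv.
rewrite /= (bigD1 i) //= mulrC -scalerA; apply: (submodZ subG) => //.
by have [] := rP i.
Qed.

Lemma filter_nzd_primes : exists k (P : 'I_k -> set R),
  [/\ forall i, prime_ideal (P i), forall i, ~ a `<=` P i
    & forall y, (forall i, ~ P i y) -> filter_nzd x N y].
Proof.
have [k [v [vcrit vsub]]] := critical_finite.
exists k, (fun i => ann (v i)); split=> [i|i|y yP m ym].
- exact: critical_prime.
- exact: critical_not_sub.
apply: contrapT => Gm; have [w wcrit mw] := critical_above Gm.
(* Both [v i] and [w] are critical, so the inclusion of annihilators is an equality. *)
have [i vw] := vsub w wcrit; apply: (yP i).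
by apply: ((vcrit i).2 w wcrit.1 vw); apply: mw; apply: sub_torsion.
Qed.

End Primes.

(** * Existence of f-generating sets of large length *)

Section Existence.
Variables (V : lmodType R).
Hypotheses (noethR : noetherian R) (fgV : fingen V).

Definition update s (x : 'I_s -> R) (i : 'I_s) (r : R) : 'I_s -> R :=
  fun j => if j == i then r else x j.

Lemma gensub_update s (x : 'I_s -> R) i r (J : {set 'I_s}) : i \notin J ->
  gensub V (update x i r) J = gensub V x J.
Proof.
move=> iJ; apply: gensub_eq => j jJ; rewrite /update; case: eqP jJ iJ => // -> -> //.
Qed.

(** The added [c] only involves the unchanged generators, so it can be subtracted again. *)
Lemma ideal_gen_update s (x : 'I_s -> R) i c :
  ideal_gen [set x j | j in [set j | j != i]] c ->
  ideal_gen (range (update x i (x i + c))) = ideal_gen (range x).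
Proof.
set x' := update x i (x i + c) => cI.
have sub (y : 'I_s -> R) : (forall j, j != i -> y j = x j) ->
    ideal_gen (range y) c.
  move=> yx; move: cI; apply: (@span_min R R^o); first exact: (@span_submodule R R^o).
  by move=> _ [j ji <-]; rewrite -yx //; apply: gen_in.
have x'x j : j != i -> x' j = x j by rewrite /x' /update => /negPf->.
have x'i : x' i = x i + c by rewrite /x' /update eqxx.
apply/seteqP; split; apply: (@span_min R R^o) => [|_ [j _ <-]];
  try exact: (@span_submodule R R^o); have [->|ji] := eqVneq j i.
- rewrite x'i; apply: (submodD (@span_submodule R R^o _)); last exact: sub.
  exact: gen_in.
- by rewrite x'x //; apply: gen_in.
- have -> : x i = x' i - c by rewrite x'i addrK.
  by apply: (submodB (@span_submodule R R^o _)); [exact: gen_in|exact: sub].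
- by rewrite -x'x //; apply: gen_in.
Qed.

Lemma filter_nzd_coset s (x : 'I_s -> R) i :
  exists2 c, ideal_gen [set x j | j in [set j | j != i]] c &
    forall J : {set 'I_s}, filter_nzd x (gensub V x J) (x i + c).
Proof.
have /choice[p pP] (J : {set 'I_s}) : exists p : {k : nat & 'I_k -> set R},
    [/\ forall i, prime_ideal (projT2 p i), forall i, ~ ideal_gen (range x) `<=` projT2 p i
      & forall y, (forall i, ~ projT2 p i y) -> filter_nzd x (gensub V x J) y].
  have [k [P PP]] := filter_nzd_primes x noethR fgV (gensub_submodule V x J).
  by exists (existT _ k P).
(* The primes attached to all subsets [J] form one finite family, so a single [c] serves every
   [J]. *)
pose T : finType := {J : {set 'I_s} & 'I_(projT1 (p J))}.
have [t|t||b /ideal_gen_rangeP[e ->]|c cI cP] := @coset_prime_avoidance T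
    (fun t => projT2 (p (tag t)) (tagged t)) (ideal_gen (range x))
    (ideal_gen [set x j | j in [set j | j != i]]) (x i).
- by have [] := pP (tag t).
- by have [] := pP (tag t).
- exact: (@span_submodule R R^o).
- exists (e i); apply/(@span_sumP R R^o s x (fun j => j != i)); exists e.
  by rewrite (bigD1 i) //= addrC addrK.
exists c => // J; have [_ _] := pP J; apply=> k.
exact: (cP (Tagged (fun J => 'I_(projT1 (p J))) k)).
Qed.

Definition regular_upto s (x : 'I_s -> R) k := forall (J : {set 'I_s}) (i : 'I_s),
  (forall j, j \in J -> (j < k)%N) -> (i < k)%N -> i \notin J ->
  filter_nzd x (gensub V x J) (x i).

(** The new [x_i] is filter regular modulo every [x_J M]. Testing an earlier [x_k] modulo a set that
    contains [i] reduces, by [filter_nzd_swap], to testing [x_k] and then [x_i] modulo the set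
    without [i]. *)
Lemma regular_upto_step s (x : 'I_s -> R) (i : 'I_s) : regular_upto x i ->
  exists2 x' : 'I_s -> R, ideal_gen (range x') = ideal_gen (range x) & regular_upto x' i.+1.
Proof.
move=> xreg; have [c cI cP] := filter_nzd_coset x i.
exists (update x i (x i + c)); first exact: ideal_gen_update.
set x' := update x i (x i + c).
have eqx' N y : filter_nzd x N y -> filter_nzd x' N y.
  by rewrite /filter_nzd /torsion ideal_gen_update.
have x'i : x' i = x i + c by rewrite /x' /update eqxx.
move=> J k Ji ki kJ; apply: eqx'.
have small (j : 'I_s) : (j < i.+1)%N -> j != i -> (j < i)%N.
  by rewrite ltnS leq_eqVlt => /orP[/eqP/ord_inj->|//]; rewrite eqxx.
have [kE|kNi] := eqVneq k i.
  by rewrite kE in kJ *; rewrite gensub_update // x'i.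
have -> : x' k = x k by rewrite /x' /update (negPf kNi).
have [iJ|iJ] := boolP (i \in J); last first.
  rewrite gensub_update //; apply: xreg => // [j jJ|]; last exact: small.
  by apply: small; [exact: Ji|apply: contraNneq iJ => <-].
pose J' := (J :\ i)%SET; have iJ' : i \notin J' by rewrite !inE eqxx.
have kJ' : k \notin J' by rewrite !inE negb_and kJ orbT.
have J'i j : j \in J' -> (j < i)%N by rewrite !inE => /andP[ji /Ji jlt]; apply: small.
rewrite -(finset.setD1K iJ) -/J' gensub_add_multiples // gensub_update // x'i.
apply: filter_nzd_swap; first exact: gensub_submodule.
  by apply: xreg => //; apply: small.
by rewrite -gensub_add_multiples.
Qed.

Lemma exists_subset_regular s (x : 'I_s -> R) :
  exists2 x' : 'I_s -> R, ideal_gen (range x') = ideal_gen (range x)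
    & subset_regular x' V x'.
Proof.
suff [x' x'x x'reg] : exists2 x' : 'I_s -> R, ideal_gen (range x') = ideal_gen (range x)
    & regular_upto x' s.
  by exists x' => // J i; apply: x'reg => // j _; apply: ltn_ord.
suff upto k : (k <= s)%N -> exists2 x' : 'I_s -> R,
    ideal_gen (range x') = ideal_gen (range x) & regular_upto x' k by exact: upto.
elim: k => [|k IH] ks; first by exists x.
have [x1 x1x x1reg] := IH (ltnW ks).
have [x2 x2x x2reg] := @regular_upto_step s x1 (Ordinal ks) x1reg.
by exists x2 => //; rewrite x2x.
Qed.

Lemma exists_f_generating (a : set R) n : ideal a ->
  exists s (x : 'I_s -> R), f_generating a V x /\ (n <= s)%N.
Proof.
move=> ida; have [m [y yE]] := noethR ida.
(* Appending [n] zeros to a generating family makes the length at least [n]; these entries too are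
   then modified. *)
pose z (k : 'I_(m + n)) := match fintype.split k with inl j => y j | inr _ => 0 end.
have [x xz xreg] := exists_subset_regular z.
have za : ideal_gen (range z) = a.
  rewrite -yE; apply/seteqP; split; apply: (@span_min R R^o) => [|_ [j _ <-]];
    try exact: (@span_submodule R R^o).
    by rewrite /z; case: fintype.split => [k|_]; [exact: gen_in|apply: (submod0 (@span_submodule R R^o _))].
  have -> : y j = z (lshift n j) by rewrite /z (unsplitK (inl j : 'I_m + 'I_n)%type).
  exact: gen_in.
exists (m + n)%N, x; rewrite leq_addl; split=> //; split; first by rewrite xz.
by rewrite -za -xz; apply/subset_regularP.
Qed.

End Existence.
End Noetherian.

(** * The equivalence of the three conditions *)

Theorem theorem2p7 (R : comPzRingType) (a : set R) (M : lmodType R) (n : nat)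
    (noethR : noetherian R) (ideal_a : ideal a) (fgM : fingen M)
    (n_gt0 : (0 < n)%N) :
  let any_n_weak (s : nat) (x : 'I_s -> R) :=
    forall f : 'I_n -> 'I_s, injective f ->
      uncond_weak_sequence a M (fun k => x (f k)) in
  let cond_i :=
    forall (s : nat) (x : 'I_s -> R),
      f_generating a M x -> (n <= s)%N -> any_n_weak s x in
  let cond_ii :=
    exists (s : nat) (x : 'I_s -> R),
      [/\ f_generating a M x, (n <= s)%N & any_n_weak s x] in
  let cond_iii :=
    exists (s : nat) (x : 'I_s -> R),
      [/\ f_generating a M x, (n <= s)%N
        & forall i : nat, (i <= n.-1)%N ->
            forall y : local_cohomology M x i,
              exists h : koszul_cohomology M x i, lambda M x i h = y] in
  (cond_i <-> cond_ii) /\ (cond_ii <-> cond_iii).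
Proof.
move=> any_n_weak cond_i cond_ii cond_iii.
have i_ii : cond_i -> cond_ii.
  have [s [x [xgen ns]]] := exists_f_generating noethR fgM n ideal_a.
  by move=> ci; exists s, x; split=> //; apply: ci.
have ii_iii : cond_ii -> cond_iii.
  case=> s [x [xgen ns xweak]]; exists s, x; split=> // i i_n.
  apply/lambda_surjP; case: xgen => xa _; rewrite /any_n_weak -xa in xweak.
  by apply: (weak_lifts (weak_subsetsP ns xweak) ns); rewrite -(prednK n_gt0).
have iii_i : cond_iii -> cond_i.
  case=> s [x [[xa _] ns surj]] r z [za zreg] nr f injf.
  rewrite -xa in za zreg *; apply: (lifts_uncond_weak za zreg injf ns) => k kn.
  by apply/lambda_surjP; apply: surj; rewrite -ltnS prednK.
split; split=> //.
  by move=> /ii_iii/iii_i.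
by move=> /iii_i/i_ii.
Qed.
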